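(* Consider the exponential family mixture model described in the context and fix $\gamma>0$. There is a universal constant $C>0$ such that, with $$J_n=\bigg\lceil 2|X|_nM_n\log\Big(Cn^{1+\gamma}|X|_nM_n\big(|X|_nM_n+\sup_{|\theta|\le M_n}|\kappa(\theta)|\big)\Big)\bigg\rceil ,$$ where $M_n$ is as specified below, the following hold as $n\to\infty$. (i) Suppose (S1) holds, and take $M_n=M$. Then $\mathrm{supp}(\hat g)\cup\mathrm{supp}(\hat g_{J_n})\subseteq[-M_n,M_n]$; whenever $|X|_nM_n\ge 1$, $$\ell_n(f_{\hat g})-\ell_n(f_{\hat g_{J_n}})\le n^{-\gamma};$$ and $J_n=O_{\mathbb{P}}\big((\log n)^2\big)$. (ii) Suppose (S2) and (LT) hold. Then there is a constant $C_{p_0}>0$ depending only on $p_0$ such that, with $M_n=C_{p_0}|X|_n^{\alpha_1}$: whenever $|X|_n\ge 1$, $\mathrm{supp}(\hat g)\cup\mathrm{supp}(\hat g_{J_n})\subseteq[-M_n,M_n]$; whenever $|X|_n\ge1$ and $|X|_nM_n\ge 1$, $$\ell_n(f_{\hat g})-\ell_n(f_{\hat g_{J_n}})\le n^{-\gamma};$$ and $J_n=O_{\mathbb{P}}\big((\log n)^{1+(1+\alpha_1)/\beta_0}\big)$.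
   Context: Exponential family mixture model. Let $p_0$ be a probability density on $\mathbb{R}$ with respect to a dominating measure $\mu$. Put $Z(\theta)=\int \exp(\theta x)p_0(x)\,\mathrm{d}\mu(x)$, $\kappa(\theta)=\log Z(\theta)$, $\Theta=\{\theta\in\mathbb{R}:Z(\theta)<\infty\}$, and $p_\theta(x)=\exp(\theta x-\kappa(\theta))p_0(x)$ for $\theta\in\Theta$. Let $M\in(0,\infty]$ be known with $\Theta_0=\{\theta\in\mathbb{R}:|\theta|\le M\}\subseteq\Theta$ (so $\Theta_0=\mathbb{R}$ if $M=\infty$), and let $\mathcal{G}$ be the set of probability distributions $g$ with $\mathrm{supp}(g)\subseteq\Theta_0$. For $g\in\mathcal{G}$ let $f_g(x)=\int p_\theta(x)\,\mathrm{d}g(\theta)$ and $l_g(x)=\int \exp(\theta x-\kappa(\theta))\,\mathrm{d}g(\theta)$, so that $f_g=l_g p_0$. The observations $X_1,\dots,X_n$ are i.i.d. with density $f_{g_0}$ for some $g_0\in\mathcal{G}$; almost surely $p_0(X_i)>0$ for all $i$, and statements about the sample are understood almost surely. (S1): $M<\infty$ and there exists $\tau>0$ with $[-M-\tau,M+\tau]\subseteq\Theta$. (S2): $M=\infty$, $p_0$ has mean zero, and there are constants $\alpha_1\ge\alpha_2>0$ and $c_0,c_1,c_2>0$ with $c_1|\theta|^{1+1/\alpha_1}\le\kappa(\theta)\le c_2|\theta|^{1+1/\alpha_2}$ for $|\theta|\ge c_0$. (LT): there exist $\beta_0>0$ and $b_0,b_1>0$ such that $\mathbb{P}(|X|_n\ge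 t)\le n\exp(-b_1t^{\beta_0})$ for all $t\ge b_0$ (and all $n$). Constants depending ''only on $p_0$'' may depend on the constants in (S2). Notation. $|X|_n=\max_{1\le i\le n}|X_i|$; $\ell_n(f)=\sum_{i=1}^n\log f(X_i)$; $P_n$ is the empirical measure of $X_1,\dots,X_n$; $\lceil x\rceil$ is the smallest integer $\ge x$. The NPMLE $\hat g$ is any maximizer of $\ell_n(f_g)$ over $g\in\mathcal{G}$. For a (possibly random) positive integer $J_n$, $P_{J_n}$ is the order-$J_n$ Gaussian quadrature rule for $P_n$, i.e. a discrete probability measure supported on at most $J_n$ points with the same first $2J_n-1$ moments as $P_n$ (it equals $P_n$ if $J_n$ is at least the number of distinct observations), and $\hat g_{J_n}$ is any maximizer of $\int\log l_g(x)\,\mathrm{d}P_{J_n}(x)$ over $g\in\mathcal{G}$. Statements involving $\hat g_{J_n}$ are understood when $J_n$ is a positive integer. $Y_n=O_{\mathbb{P}}(a_n)$ means $Y_n/a_n$ is bounded in probability as $n\to\infty$; $0\cdot\log 0:=0$. *)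

(* Defs.v *)
From mathcomp Require Import all_boot all_order all_algebra.
From mathcomp Require Import all_classical all_reals all_analysis.
Set Implicit Arguments.
Unset Strict Implicit.
Unset Printing Implicit Defensive.
Import Order.TTheory GRing.Theory Num.Theory.
Import numFieldNormedType.Exports.
Local Open Scope classical_set_scope.
Local Open Scope ring_scope.

(* Real line with its Borel sigma-algebra; the dominating measure [mu] is an
   arbitrary Borel measure, not assumed sigma-finite. *)
Notation Borel := measurableTypeR.
Notation measureR R := {measure set (Borel R) -> \bar R}.
Notation distR R := (probability (Borel R) R).

Section exponential_family.
Variable R : realType.
Implicit Types (mu : measureR R) (g : distR R) (M : \bar R).

Definition is_density mu (p0 : R -> R) : Prop :=
  [/\ measurable_fun [set: Borel R] (p0 : Borel R -> Borel R),
      forall x, 0 <= p0 x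
    & (\int[mu]_x (p0 x)%:E = 1)%E].

Definition Zpart mu (p0 : R -> R) (t : R) : \bar R :=
  (\int[mu]_x (expR (t * x) * p0 x)%:E)%E.

Definition Theta mu (p0 : R -> R) : set R :=
  [set t | (Zpart mu p0 t < +oo)%E].

(* Only meaningful on [Theta]; off [Theta], [fine] turns +oo into 0. *)
Definition kappa mu (p0 : R -> R) (t : R) : R := ln (fine (Zpart mu p0 t)).

Definition ptheta mu (p0 : R -> R) (t x : R) : R :=
  expR (t * x - kappa mu p0 t) * p0 x.

Definition Theta0 M : set R := [set t | (`|t|%:E <= M)%E].

Definition supp g : set R := [set t | forall U, open U -> U t -> (0 < g U)%E].

Definition mixing M : set (distR R) := [set g | supp g `<=` Theta0 M].

(* [ptheta] is defined for [t] in [Theta] only, hence the integration domain;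
   every [g] in [mixing M] is carried by [Theta0 M], a subset of [Theta]. *)
Definition fmix mu (p0 : R -> R) g (x : R) : \bar R :=
  (\int[g]_(t in Theta mu p0) (ptheta mu p0 t x)%:E)%E.

Definition lmix mu (p0 : R -> R) g (x : R) : \bar R :=
  (\int[g]_(t in Theta mu p0) (expR (t * x - kappa mu p0 t))%:E)%E.

(* Given M < +oo, [fine M] is M. *)
Definition cond_S1 mu (p0 : R -> R) M : Prop :=
  (M < +oo)%E /\
  exists2 tau : R, 0 < tau &
    `[- fine M - tau, fine M + tau]%classic `<=` Theta mu p0.

Definition cond_S2 mu (p0 : R -> R) M (alpha1 alpha2 c0 c1 c2 : R) : Prop :=
  [/\ M = +oo%E,
      (\int[mu]_x (x * p0 x)%:E = 0)%E,
      0 < alpha2 /\ alpha2 <= alpha1,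
      [/\ 0 < c0, 0 < c1 & 0 < c2]
    & forall t : R, c0 <= `|t| ->
        c1 * `|t| `^ (1 + alpha1^-1) <= kappa mu p0 t
        /\ kappa mu p0 t <= c2 * `|t| `^ (1 + alpha2^-1)].

End exponential_family.

(* A sample of size n is given by the first n terms x 0, ..., x n.-1 of a
   sequence, standing for X_1, ..., X_n. *)
Section estimation.
Variable R : realType.
Implicit Types (mu : measureR R) (g : distR R) (M : \bar R).
Implicit Types (n : nat) (x : nat -> R).

Definition maxabs n x : R := \big[Num.max/0]_(i < n) `|x i|.

Definition loglik n x (f : R -> \bar R) : \bar R :=
  (\sum_(i < n) lne (f (x i)))%E.

Definition empirical n x : measureR R :=
  mscale (n%:R^-1)%:nng (msum (fun i => dirac (x i : Borel R)) n).

Definition npmle mu (p0 : R -> R) M n x g : Prop :=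
  mixing M g /\
  forall h : distR R, mixing M h ->
    (loglik n x (fmix mu p0 h) <= loglik n x (fmix mu p0 g))%E.

Definition distinct_obs n x : nat := size (undup [seq x i | i <- iota 0 n]).

Definition gauss_quadrature n x (J : nat) (Q : distR R) : Prop :=
  [/\ exists2 s : seq R, (size s <= J)%N & Q [set t | t \in s] = 1%E,
      forall k : nat, (k <= (2 * J).-1)%N ->
        (\int[Q]_t (t ^+ k)%:E = \int[empirical n x]_t (t ^+ k)%:E)%E
    & (distinct_obs n x <= J)%N ->
      forall A : set (Borel R), measurable A -> Q A = empirical n x A].

Definition quad_npmle mu (p0 : R -> R) M n x (J : nat) g : Prop :=
  exists2 Q : distR R, gauss_quadrature n x J Q &
    mixing M g /\
    forall h : distR R, mixing M h ->
      (\int[Q]_t lne (lmix mu p0 h t) <= \int[Q]_t lne (lmix mu p0 g t))%E.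

(* The supremum is over a nonempty set, bounded as soon as [-Mn, Mn] is a
   subset of [Theta] and 0 <= Mn.  As [ln 0 = 0], the order is 0 when
   |X|_n Mn = 0, in accordance with 0 * log 0 = 0. *)
Definition quad_order mu (p0 : R -> R) (C gamma : R) n x (Mn : R) : int :=
  let a := maxabs n x * Mn in
  let K := sup [set `|kappa mu p0 t| | t in `[- Mn, Mn]%classic] in
  Num.ceil (2 * a * ln (C * n%:R `^ (1 + gamma) * a * (a + K))).

End estimation.

Section sampling.
Variables (R : realType) (d : measure_display) (T : measurableType d).
Variable P : probability T R.
Implicit Types X : nat -> {RV P >-> Borel R}.

Definition mutually_independent X : Prop :=
  forall (s : seq nat) (A : nat -> set (Borel R)), uniq s ->
    (forall i, measurable (A i)) ->
    P (\bigcap_(i in [set j | j \in s]) X i @^-1` A i)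
      = (\prod_(i <- s) P (X i @^-1` A i))%E.

Definition iid_with_density X (mu : measureR R) (f : R -> \bar R) : Prop :=
  mutually_independent X /\
  forall i (A : set (Borel R)), measurable A ->
    (distribution P (X i) A = \int[mu]_(x in A) f x)%E.

Definition cond_LT X (beta0 b0 b1 : R) : Prop :=
  [/\ 0 < beta0, 0 < b0, 0 < b1
    & forall (n : nat) (t : R), (0 < n)%N -> b0 <= t ->
        (P [set w | t <= maxabs n (fun i => X i w)]%R
          <= (n%:R * expR (- b1 * t `^ beta0))%:E)%E].

(* Y_n = O_P(a_n) *)
Definition bounded_in_prob (Y : nat -> T -> R) (a : nat -> R) : Prop :=
  forall e : R, 0 < e -> exists B : R,
    \forall n \near \oo, (P [set w | B < `|Y n w / a n|]%R <= e%:E)%E.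

End sampling.

(* Main.v *)
(** Tilting by [exp (- kappa)], [ln (l_g x)] is the logarithm of a Laplace
    transform of a measure on [[-M, M]].  With [x = A u], [|u| <= 1] and
    [a = A M], it is close to [ln (p u)], where [p u] integrates
    [(1 + s u / m) ^ m] over [|s| <= a].  This is a real polynomial whose
    real part stays positive on a Bernstein ellipse of parameter about
    [1 + 1 / (2 a)], so that its complex roots [z] lie outside the ellipse.
    Writing [z = (v + 1 / v) / 2] with [|v| < 1], the Chebyshev expansion
    [ln |1 - 2 u v + v^2| = - \sum_k (2 / k) Re (v ^ k) T_k u]
    gives a polynomial approximation of [ln l_g] of degree [2 J - 1] and error
    about [exp (- J / a)].  The nodes of a Gaussian rule lie in the convex hull
    of the data, and the rule integrates this polynomial exactly, so the
    objective functions of the two estimators differ by at most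
    [n ^ (- 1 - gamma)].  For [M = oo], convexity of [kappa] shows that moving
    the mass of [g] outside [[-M_n, M_n]] to the endpoints strictly raises
    [l_g] on [[-A, A]], which localizes both estimators. *)
Require Import Defs.
From HB Require Import structures.
From mathcomp Require Import all_boot all_order all_algebra.
From mathcomp Require Import all_classical all_reals all_analysis.
From mathcomp Require Import measurable_realfun complex zify ring lra.
Set Implicit Arguments.
Unset Strict Implicit.
Unset Printing Implicit Defensive.
Import Order.TTheory GRing.Theory Num.Theory.
Import numFieldNormedType.Exports ComplexField.Normc.
Local Open Scope classical_set_scope.
Local Open Scope ring_scope.

(** * Complex logarithms and Chebyshev expansions *)

(** Replacing [exp] by [(1 + . / m) ^ m] trades analytic function theory for algebra: the transform
    becomes a polynomial fixed by finitely many moments, and its logarithm is a finite sum of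
    logarithms of distances to roots. The price is that the error of the Chebyshev expansion is
    multiplied by the number of roots, at most [m]. With [X = n ^ (1 + gamma)], the power must be of
    order [a ^ 2 X] to bring the first error [a ^ 2 / m] below a fraction of [1 / X]; as the
    expansion error decays like [exp (- J / a)], this polynomial factor is absorbed by the logarithm
    in [J_n]. The size of the ellipse is dictated by positivity: the argument of a factor
    [1 + s z / m] with [|s| <= a] must stay of order [1 / m], which limits the imaginary semi-axis
    to order [1 / a]. *)

Section complex_modulus.
Variable R : realType.
Local Notation C := (complex R).
Local Notation Re := (@complex.Re R).
Local Notation Im := (@complex.Im R).
Implicit Types z w : C.

Lemma normc_ge0 z : 0 <= normc z.
Proof. by case: z => x y; exact: sqrtr_ge0. Qed.

Lemma normc_eq0 z : (normc z == 0) = (z == 0).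
Proof.
by apply/eqP/eqP => [/eq0_normc|->]; last exact: normc0.
Qed.

Lemma normc_gt0 z : (0 < normc z) = (z != 0).
Proof. by rewrite lt_neqAle normc_ge0 andbT eq_sym normc_eq0. Qed.

Lemma ler_normcD z w : normc (z + w) <= normc z + normc w.
Proof. exact: (@le_normcD R z w). Qed.

Lemma normc_opp z : normc (- z) = normc z.
Proof. exact: (@normcN R z). Qed.

Lemma normcX z n : normc (z ^+ n) = normc z ^+ n.
Proof.
by elim: n => [|n IH]; rewrite ?expr0 ?normc1// !exprS normcM IH.
Qed.

Lemma normcE2 z : normc z = Num.sqrt (Re z ^+ 2 + Im z ^+ 2).
Proof. by case: z. Qed.

Lemma normc_ge_absRe z : `|Re z| <= normc z.
Proof. by rewrite normcE2 -sqrtr_sqr ler_wsqrtr// lerDl sqr_ge0. Qed.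

Lemma normc_realc (x : R) : normc (real_complex R x) = `|x|.
Proof. by rewrite normcE2/= expr0n/= addr0 sqrtr_sqr. Qed.

Lemma ReD z w : Re (z + w) = Re z + Re w.
Proof. by case: z w => [a b] [c d]. Qed.

Lemma ReN z : Re (- z) = - Re z.
Proof. by case: z. Qed.

Lemma ReZ (x : R) z : Re (real_complex R x * z) = x * Re z.
Proof. by case: z => a b /=; rewrite mul0r subr0. Qed.

Lemma Re_sum (I : Type) (s : seq I) (F : I -> C) :
  Re (\sum_(i <- s) F i) = \sum_(i <- s) Re (F i).
Proof. by elim/big_ind2: _ => // x1 x2 y1 y2 <- <-; rewrite ReD. Qed.

End complex_modulus.

Section log_one_minus.
Variable R : realType.
Local Notation C := (complex R).
Local Notation Re := (@complex.Re R).
Local Notation Im := (@complex.Im R).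
Local Notation "x %:C" := (real_complex R x).

Lemma normc_1B_sqr (z : C) (t : R) :
  normc (1 - t%:C * z) ^+ 2 = 1 - 2 * t * Re z + t ^+ 2 * normc z ^+ 2.
Proof.
rewrite !normcE2 !sqr_sqrtr ?addr_ge0 ?sqr_ge0//.
by case: z => a b /=; ring.
Qed.

(** No complex logarithm is involved: along [t |-> 1 - t z], the derivative of the remainder is
    [- Re (z (t z) ^ N / (1 - t z))], and the mean value theorem on [[0, 1]] concludes. *)
Lemma ln_normc1B_taylor (z : C) (r : R) (N : nat) : 0 <= r < 1 -> normc z <= r ->
  `|ln (normc (1 - z)) + \sum_(k < N) Re (z ^+ k.+1) / k.+1%:R|
    <= r ^+ N.+1 / (1 - r).
Proof.
move=> /andP[r0 r1] zr.
have lb (t : R) : t \in `[0, 1] -> 1 - r <= normc (1 - t%:C * z).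
  rewrite in_itv/= => /andP[t0 t1].
  have := ler_normcD (1 - t%:C * z) (t%:C * z).
  rewrite subrK normc1 normcM normc_realc ger0_norm//.
  have := normc_ge0 z; nra.
have nz (t : R) : t \in `[0, 1] -> 1 - t%:C * z != 0.
  move=> /lb h; rewrite -normc_gt0; lra.
pose q (t : R) := 1 - 2 * t * Re z + t ^+ 2 * normc z ^+ 2.
have q0 (t : R) : t \in `[0, 1] -> 0 < q t.
  by move=> /nz h; rewrite /q -normc_1B_sqr exprn_gt0// normc_gt0.
pose h (t : R) := 2^-1 * ln (q t) + \sum_(k < N) Re (z ^+ k.+1) / k.+1%:R * t ^+ k.+1.
pose dh (t : R) := 2^-1 * ((q t)^-1 * (- 2 * Re z + 2 * t * normc z ^+ 2))
  + \sum_(k < N) Re (z ^+ k.+1) * t ^+ k.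
have h0 : h 0 = 0.
  rewrite /h /q !(mulr0, mul0r, expr0n, subr0, addr0) ln1 mulr0 add0r.
  by apply: big1 => k _; rewrite expr0n mulr0.
have h1 : h 1 = ln (normc (1 - z)) + \sum_(k < N) Re (z ^+ k.+1) / k.+1%:R.
  rewrite /h; congr (_ + _); last by apply: eq_bigr => k _; rewrite expr1n mulr1.
  rewrite /q -normc_1B_sqr mul1r lnXn; last first.
    have := nz 1; rewrite mul1r normc_gt0; apply; by rewrite in_itv/= lexx ler01.
  by rewrite -[X in _ * X]mulr_natl mulrA mulVf ?mul1r// pnatr_eq0.
have dhE (t : R) : t \in `[0, 1] -> is_derive t 1 h (dh t).
  move=> t01; have qt := q0 _ t01.
  have dq : is_derive t 1 q (- 2 * Re z + 2 * t * normc z ^+ 2).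
    rewrite /q; apply: is_derive_eq.
    by rewrite !scaler1 ?scale0r; rewrite /GRing.scale/=; ring.
  have dl : is_derive t 1 (fun s => ln (q s)) ((q t)^-1 * (- 2 * Re z + 2 * t * normc z ^+ 2)).
    have := @is_derive1_comp R (@ln R) q t _ _ (is_derive1_ln qt) dq.
    by move=> H; apply: is_derive_eq H _; rewrite mulrC.
  apply: is_deriveD.
  have -> : (fun t : R => \sum_(k < N) Re (z ^+ k.+1) / k.+1%:R * t ^+ k.+1) =
     \sum_(k < N) (fun t : R => Re (z ^+ k.+1) / k.+1%:R * t ^+ k.+1).
    by apply/funext => s; rewrite fct_sumE.
  apply: is_derive_sum => k.
  rewrite (_ : (fun _ => _) = horner ((Re (z ^+ k.+1) / k.+1%:R) *: 'X^(k.+1))).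
    apply: is_derive_eq.
    by rewrite derivZ derivXn hornerZ hornerMn hornerXn/= mulrnAr -mulrnAl
      -[X in X * _]mulr_natr divfK// pnatr_eq0.
  by apply/funext => s; rewrite hornerZ hornerXn.
have dhb (t : R) : t \in `[0, 1] -> `|dh t| <= r ^+ N.+1 / (1 - r).
  move=> t01; have zt := nz _ t01; have := lb _ t01.
  have qt := q0 _ t01.
  have -> : dh t = - Re (z * (t%:C * z) ^+ N / (1 - t%:C * z)).
    rewrite /dh.
    have -> : \sum_(k < N) Re (z ^+ k.+1) * t ^+ k =
        Re (z / (1 - t%:C * z)) - Re (z * (t%:C * z) ^+ N / (1 - t%:C * z)).
      rewrite -ReN -ReD -mulrBl -[X in (X - _) / _](mulr1 z) -mulrBr.
      have -> : 1 - (t%:C * z) ^+ N = (1 - t%:C * z) * \sum_(k < N) (t%:C * z) ^+ k.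
        by rewrite -[LHS]opprB subrX1 -mulNr opprB.
      rewrite mulrCA mulrAC divff// mul1r.
      rewrite mulr_sumr Re_sum; apply: eq_bigr => k _.
      by rewrite mulrC exprMn -rmorphXn mulrCA -exprS ReZ.
    (* The derivative of [ln |1 - t z|] is [- Re (z / (1 - t z))], which cancels the sum of the full
       geometric series. *)
    rewrite addrA (_ : _ + Re (z / _) = 0) ?add0r//.
    move: qt; rewrite /q normcE2 sqr_sqrtr ?addr_ge0 ?sqr_ge0//.
    case: (z) => a b /= qt; field.
    move: qt; lra.
  rewrite normrN => h1r.
  apply: le_trans (normc_ge_absRe _) _.
  rewrite !normcM normcX normcM normc_realc normcV exprS.
  move: t01; rewrite in_itv/= => /andP[t0 t1].
  apply: ler_pM; rewrite ?invr_ge0 ?mulr_ge0 ?exprn_ge0 ?mulr_ge0 ?normc_ge0//.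
    apply: ler_pM; rewrite ?exprn_ge0 ?mulr_ge0 ?normc_ge0//.
    apply: lerXn2r; rewrite ?nnegrE ?mulr_ge0 ?normc_ge0//.
    by rewrite ger0_norm//; have := normc_ge0 z; nra.
  by rewrite lef_pV2 ?posrE// ?normc_gt0// subr_gt0.
have hc : {within `[0, 1], continuous h}.
  apply: derivable_within_continuous => t t01.
  by have := dhE _ t01; case.
have [c c01] := MVT_segment ler01 (fun t t01 => dhE t (subset_itv_oo_cc t01)) hc.
rewrite h0 subr0 subr0 mulr1 -h1 => ->.
exact: dhb.
Qed.
End log_one_minus.

Section chebyshev.
Variable R : realType.
Local Notation C := (complex R).
Local Notation Re := (@complex.Re R).
Local Notation Im := (@complex.Im R).
Local Notation "x %:C" := (real_complex R x).

(* The pair [(T_n, T_(n+1))] of Chebyshev polynomials of the first kind. *)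
Fixpoint chebyshev (n : nat) : {poly R} * {poly R} :=
  if n is k.+1 then
    ((chebyshev k).2, 2 *: ('X * (chebyshev k).2) - (chebyshev k).1)
  else (1, 'X).

Lemma size_chebyshev n :
  (size (chebyshev n).1 <= n.+1)%N /\ (size (chebyshev n).2 <= n.+2)%N.
Proof.
elim: n => [|n [IH1 IH2]] /=; first by rewrite size_poly1 size_polyX.
split=> //; apply: leq_trans (size_polyD _ _) _.
rewrite geq_max size_polyN (leq_trans IH1) ?andbT; last by rewrite leqW// leqW.
apply: leq_trans (size_scale_leq _ _) _.
by apply: leq_trans (size_polyMleq _ _) _; rewrite size_polyX.
Qed.

(** On the unit circle, [e ^ 2] is [2 e] times the real part of [e], minus 1. Multiplied by [e ^ n],
    this is the three-term recurrence, so that [T_n (cos t) = cos (n t)] is obtained without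
    angles. *)
Lemma horner_chebyshev (e : C) n : normc e = 1 ->
  (chebyshev n).1.[Re e] = Re (e ^+ n) /\
  (chebyshev n).2.[Re e] = Re (e ^+ n.+1).
Proof.
move=> e1; have e2 : e ^+ 2 = 2%:C * (Re e)%:C * e - 1.
  have : normc e ^+ 2 = 1 by rewrite e1 expr1n.
  rewrite normcE2 sqr_sqrtr ?addr_ge0 ?sqr_ge0//.
  case: {e1} e => x y /= h; rewrite expr2; apply/eqP.
  rewrite eq_complex/=; apply/andP; split; apply/eqP; nra.
elim: n => [|n [IH1 IH2]] /=; first by rewrite hornerC hornerX expr1.
split=> //; rewrite hornerD hornerN hornerZ hornerM hornerX IH1 IH2.
have -> : e ^+ n.+2 = 2%:C * ((Re e)%:C * e ^+ n.+1) - e ^+ n.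
  by rewrite -addn2 exprD e2 mulrBr mulr1 exprS; ring.
by rewrite ReD ReN ReZ ReZ.
Qed.

(** [v] is a root of [X ^ 2 - 2 z X + 1]; the product of the two roots is 1, so one of them lies in
    the closed unit disc. *)
Lemma joukowski_surj (z : C) :
  exists v, [/\ v != 0, normc v <= 1 & z = (v + v^-1) / 2%:R].
Proof.
pose p : {poly C} := 'X * 'X - (2%:R * z) *: 'X + 1.
have sp : size p = 3%N.
  rewrite /p -expr2 -addrA size_polyDl size_polyXn//.
  apply: leq_ltn_trans (size_polyD _ _) _.
  rewrite gtn_max size_poly1 andbT size_polyN.
  by apply: leq_ltn_trans (size_scale_leq _ _) _; rewrite size_polyX.
have sp1 : size p != 1%N by rewrite sp.
have [v /rootP] := closed_rootP p sp1.
rewrite /p !hornerE => hv.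
have v0 : v != 0.
  apply/eqP => v0; move: hv; rewrite v0 !mulr0 subr0 add0r => /eqP.
  by rewrite oner_eq0.
have zE : z = (v + v^-1) / 2%:R.
  have h : 2%:R * z * v = v ^+ 2 + 1.
    by apply/eqP; rewrite -subr_eq0; apply/eqP; rewrite -[RHS]oppr0 -hv; ring.
  apply: (mulIf v0); apply: (@mulfI _ 2%:R); first by rewrite pnatr_eq0.
  by rewrite mulrA h; field; rewrite v0.
have [v1|v1] := leP (normc v) 1; first by exists v.
exists v^-1; split; rewrite ?invr_eq0// ?invrK 1?addrC// normcV.
by rewrite invf_le1 ?ltW// (lt_trans ltr01).
Qed.

(** With [s = |v|], the coordinates of the image are those of [v] times [(1 + s ^ -2) / 2] and
    [(1 - s ^ -2) / 2]. Both [s + 1 / s] and [1 / s - s] decrease on []0, 1]], so [s = r] is the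
    worst case. *)
Lemma joukowski_ellipse (v : C) (r : R) : 0 < r -> r <= normc v <= 1 ->
  `|Re ((v + v^-1) / 2%:R)| <= (r + r^-1) / 2 /\
  `|Im ((v + v^-1) / 2%:R)| <= (r^-1 - r) / 2.
Proof.
move=> r0 /andP[rv v1].
have vE : (v + v^-1) / 2%:R =
   Complex (Re v * (1 + (normc v) ^- 2) / 2) (Im v * (1 - (normc v) ^- 2) / 2).
  have h2 : (2%:R : C)^-1 = 2^-1%:C.
    by rewrite fmorphV/= -[2%:R : C](rmorph_nat (real_complex R)).
  have : 0 < normc v ^+ 2 by rewrite exprn_gt0// (lt_le_trans r0).
  rewrite h2 normcE2 sqr_sqrtr ?addr_ge0 ?sqr_ge0//.
  case: {rv v1 h2} v => x y /= h; apply/eqP; rewrite eq_complex/=.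
  by apply/andP; split; apply/eqP; field; rewrite gt_eqF.
move: vE rv v1; rewrite normcE2; set x := Re v; set y := Im v => vE rv v1.
have s0 : 0 < x ^+ 2 + y ^+ 2.
  by rewrite -sqrtr_gt0; apply: lt_le_trans rv.
set s := Num.sqrt _ in rv v1 vE; have sE : s ^+ 2 = x ^+ 2 + y ^+ 2 by rewrite sqr_sqrtr// ltW.
have sp : 0 < s by apply: lt_le_trans rv.
have xs : `|x| <= s by rewrite /s -sqrtr_sqr ler_wsqrtr// lerDl sqr_ge0.
have ys : `|y| <= s by rewrite /s -sqrtr_sqr ler_wsqrtr// lerDr sqr_ge0.
rewrite {}vE/=.
have srr : r^-1 - s^-1 = (s - r) / (r * s) by field; rewrite !gt_eqF.
have si : 1 <= s^-1 by rewrite invf_ge1.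
have rsi : s^-1 <= r^-1 by rewrite lef_pV2.
have sss : s * s^-2 = s^-1 by field; rewrite gt_eqF.
have si2 : 1 <= s^-2 by rewrite invf_ge1 ?exprn_gt0// expr_le1// ltW.
split=> /=.
  rewrite normrM normrM [`|2^-1|]ger0_norm// ler_pM2r//.
  rewrite [`|1 + _|]ger0_norm; last by lra.
  apply: (@le_trans _ _ (s * (1 + s^-2))).
    by rewrite ler_pM2r//; lra.
  rewrite mulrDr mulr1 sss.
  have : (s - r) * (1 / (r * s) - 1) >= 0.
    rewrite mulr_ge0// ?subr_ge0// div1r invf_ge1 ?mulr_gt0//; nra.
  by rewrite mulrBr mulrA mulr1 -srr; lra.
rewrite normrM normrM [`|2^-1|]ger0_norm// ler_pM2r//.
rewrite [`|1 - _|]ler0_norm; last by lra.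
apply: (@le_trans _ _ (s * (s^-2 - 1))).
  by rewrite opprB ler_wpM2r// subr_ge0.
by rewrite mulrBr mulr1 sss; lra.
Qed.

(** By contraposition of [joukowski_ellipse], the preimage [v] of such a [z] lies in the disc of
    radius [r]. Each of the two conjugate factors below costs [r ^ N.+1 / (1 - r)], whence the 2. *)
Lemma ln_dist_approx (z : C) (r : R) (N : nat) : 0 < r < 1 ->
  ~ (`|Re z| <= (r + r^-1) / 2 /\ `|Im z| <= (r^-1 - r) / 2) ->
  exists2 q : {poly R}, (size q <= N.+1)%N &
    forall u, -1 <= u <= 1 ->
      `|ln (normc (u%:C - z)) - q.[u]| <= 2 * r ^+ N.+1 / (1 - r).
Proof.
move=> /andP[r0 r1] zE.
have [v [v0 v1 zv]] := joukowski_surj z.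
have vr : normc v <= r.
  rewrite leNgt; apply/negP => rv; apply: zE; rewrite zv.
  by apply: joukowski_ellipse => //; rewrite (ltW rv).
pose q := - (ln (2 * normc v))%:P
  - \sum_(k < N) (2 * Re (v ^+ k.+1) / k.+1%:R) *: (chebyshev k).2.
exists q.
  rewrite /q -opprD size_polyN.
  apply: leq_trans (size_polyD _ _) _; rewrite geq_max; apply/andP; split.
    by apply: leq_trans (size_polyC_leq1 _) _.
  apply: leq_trans (size_sum _ _ _) _; apply/bigmax_leqP => k _.
  apply: leq_trans (size_scale_leq _ _) _.
  by apply: leq_trans (size_chebyshev k).2 _; rewrite ltnS.
move=> u /andP[u0 u1].
(* For [u = cos t] these are [exp (i t)] and [exp (- i t)]; the identity [fac] splits [u - z] into
   the factors [1 - v e] and [1 - v e']. *)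
pose e : C := Complex u (Num.sqrt (1 - u ^+ 2)).
pose e' : C := Complex u (- Num.sqrt (1 - u ^+ 2)).
have s2 : Num.sqrt (1 - u ^+ 2) ^+ 2 = 1 - u ^+ 2 by rewrite sqr_sqrtr//; nra.
have ne : normc e = 1 by rewrite normcE2/= s2 subrKC sqrtr1.
have ne' : normc e' = 1 by rewrite normcE2/= sqrrN s2 subrKC sqrtr1.
have ee' : e + e' = 2%:R * u%:C.
  apply/eqP; rewrite mulr_natl eq_complex /=; apply/andP; split; apply/eqP; lra.
have ee1 : e * e' = 1.
  by apply/eqP; rewrite eq_complex/=; apply/andP; split; apply/eqP; nra.
have vr2 : normc v < 1 by apply: le_lt_trans r1.
have fac : u%:C - z = - ((1 - v * e) * (1 - v * e') / (2%:R * v)).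
  have -> : (1 - v * e) * (1 - v * e') = 1 - v * (2%:R * u%:C) + v ^+ 2.
    have -> : v ^+ 2 = v ^+ 2 * (e * e') by rewrite ee1 mulr1.
    by rewrite -ee'; ring.
  by rewrite zv; field; rewrite v0.
have ln1 (w : C) : normc w = 1 -> normc (v * w) <= r.
  by move=> w1; rewrite normcM w1 mulr1.
have pos (w : C) : normc w = 1 -> 0 < normc (1 - v * w).
  move=> w1; have := ler_normcD (1 - v * w) (v * w).
  by rewrite subrK normc1 normcM w1 mulr1; lra.
rewrite fac normc_opp !normcM normcV normcM.
have -> : normc (2%:R : C) = 2.
  by rewrite -[2%:R : C](rmorph_nat (real_complex R)) normc_realc ger0_norm.
rewrite lnM ?posrE ?mulr_gt0 ?pos ?invr_gt0 ?mulr_gt0 ?normc_gt0//.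
rewrite lnM ?posrE ?pos// lnV ?posrE ?mulr_gt0 ?normc_gt0//.
rewrite /q hornerD !hornerN hornerC horner_sum.
have r01 : 0 <= r < 1 by rewrite ltW.
have He := ln_normc1B_taylor N r01 (ln1 _ ne).
have He' := ln_normc1B_taylor N r01 (ln1 _ ne').
have -> : \sum_(k < N) ((2 * Re (v ^+ k.+1) / k.+1%:R) *: (chebyshev k).2).[u] =
   \sum_(k < N) Re ((v * e) ^+ k.+1) / k.+1%:R +
   \sum_(k < N) Re ((v * e') ^+ k.+1) / k.+1%:R.
  rewrite -big_split; apply: eq_bigr => k _ /=.
  rewrite hornerZ (horner_chebyshev k ne).2.
  rewrite -mulrDl -ReD !exprMn -mulrDr mulrAC; congr (_ / _).
  have -> : e' ^+ k.+1 = conjc (e ^+ k.+1) by rewrite rmorphXn.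
  by case: (v ^+ k.+1) (e ^+ k.+1) => [a b] [c d] /=; ring.
set S := \sum_(k < N) _ in He *; set S' := \sum_(k < N) _ in He' *.
rewrite (_ : _ - _ = (ln (normc (1 - v * e)) + S) + (ln (normc (1 - v * e')) + S')).
  by apply: le_trans (ler_normD _ _) _; lra.
by ring.
Qed.
End chebyshev.

Section zero_free_polynomial.
Variable R : realType.
Local Notation C := (complex R).
Local Notation Re := (@complex.Re R).
Local Notation Im := (@complex.Im R).
Local Notation "x %:C" := (real_complex R x).

(** The rectangle circumscribed about the Bernstein ellipse of parameter [1 / r]. It can be tested
    coordinatewise, and a root outside it is outside the ellipse. *)
Definition ellipse (r : R) (z : C) : Prop :=
  `|Re z| <= (r + r^-1) / 2 /\ `|Im z| <= (r^-1 - r) / 2.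

Lemma segment_ellipse (r u : R) : 0 < r < 1 -> -1 <= u <= 1 -> ellipse r u%:C.
Proof.
move=> /andP[r0 r1] u1; rewrite /ellipse/= normr0.
have rV : r * r^-1 = 1 by rewrite divff// gt_eqF.
have rV1 : 1 < r^-1 by rewrite invf_gt1.
split; last by lra.
rewrite (@le_trans _ _ 1)// ?ler_norml//; nra.
Qed.

Lemma ln_prod_dist_approx (zs : seq C) (r : R) (N : nat) : 0 < r < 1 ->
  (forall z, z \in zs -> ~ ellipse r z) ->
  exists2 q : {poly R}, (size q <= N.+1)%N &
    forall u, -1 <= u <= 1 ->
      `|ln (normc (\prod_(z <- zs) (u%:C - z))) - q.[u]|
        <= (size zs)%:R * (2 * r ^+ N.+1 / (1 - r)).
Proof.
move=> r01; elim: zs => [|z zs IH] hz.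
  exists 0; first by rewrite size_poly0.
  by move=> u _; rewrite big_nil normc1 ln1 horner0 subrr normr0 mul0r.
have [z' z'zs|q sq hq] := IH; first by apply: hz; rewrite in_cons z'zs orbT.
have [|q' sq' hq'] := ln_dist_approx N r01 (z := z).
  by apply: hz; rewrite mem_head.
exists (q' + q); first by rewrite (leq_trans (size_polyD _ _))// geq_max sq'.
move=> u u1; rewrite big_cons normcM lnM ?posrE ?normc_gt0; last 2 first.
- rewrite subr_eq0; apply/eqP => uz; apply: (hz z (mem_head _ _)).
  by rewrite -uz; exact: segment_ellipse.
- rewrite prodf_seq_neq0; apply/allP => w wzs /=; rewrite subr_eq0.
  apply/eqP => uw; apply: (hz w); first by rewrite in_cons wzs orbT.
  by rewrite -uw; exact: segment_ellipse.
rewrite hornerD /= -natr1 mulrDl mul1r [X in _ <= X]addrC opprD addrACA.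
by apply: le_trans (ler_normD _ _) _; apply: lerD; [exact: hq'|exact: hq].
Qed.

(** Over the complex numbers [p] splits into at most [m] linear factors, each costing one error term
    of [ln_dist_approx]; the leading coefficient only shifts the constant term of [q]. *)
Lemma ln_poly_approx (p : {poly R}) (r : R) (m N : nat) : 0 < r < 1 ->
  (size p <= m.+1)%N ->
  (forall z, ellipse r z -> (map_poly (real_complex R) p).[z] != 0) ->
  exists2 q : {poly R}, (size q <= N.+1)%N &
    forall u, -1 <= u <= 1 ->
      `|ln `|p.[u]| - q.[u]| <= m%:R * (2 * r ^+ N.+1 / (1 - r)).
Proof.
move=> r01 sp hp; set P := map_poly _ p in hp *.
have [zs PE] := closed_field_poly_normal P.
have P0 : P != 0.
  have h0 : -1 <= (0 : R) <= 1 by rewrite lerN10 ler01.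
  by apply: contra_neq (hp _ (@segment_ellipse r 0 r01 h0)) => ->; rewrite horner0.
have lP : lead_coef P != 0 by rewrite lead_coef_eq0.
move: PE lP; move: (lead_coef P) => c PE lP.
have zsE z : z \in zs -> ~ ellipse r z.
  move=> zzs /hp /negP; apply; rewrite PE hornerZ mulf_eq0.
  by move: zzs; rewrite -root_prod_XsubC => /eqP ->; rewrite eqxx orbT.
have szs : (size zs <= m)%N.
  rewrite -ltnS -(size_prod_XsubC _ id) -(size_scale _ lP) -PE.
  by rewrite size_map_poly.
have [q sq hq] := ln_prod_dist_approx N r01 zsE.
exists (q + (ln (normc c))%:P).
  rewrite (leq_trans (size_polyD _ _))// geq_max sq.
  by rewrite (leq_trans (size_polyC_leq1 _)).
move=> u u1.
have := hp _ (@segment_ellipse r u r01 u1).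
rewrite -[`|p.[u]|]normc_realc -horner_map -/P PE hornerZ.
rewrite horner_prod.
under eq_bigr do rewrite hornerXsubC.
rewrite mulf_eq0 negb_or lP /= => pr0.
rewrite normcM lnM ?posrE ?normc_gt0//.
rewrite hornerD hornerC [X in X - _]addrC opprD addrACA subrr addr0.
apply: le_trans (hq _ u1) _; apply: ler_wpM2r; last by rewrite ler_nat.
have /andP[r0 r1] := r01.
by rewrite divr_ge0 ?mulr_ge0 ?exprn_ge0 ?subr_ge0// ltW.
Qed.

End zero_free_polynomial.

(** * Elementary bounds for powers close to exponentials *)

Section power_estimates.
Variable R : realType.
Local Notation C := (complex R).
Local Notation Re := (@complex.Re R).
Local Notation Im := (@complex.Im R).
Local Notation "x %:C" := (real_complex R x).

(** The binomial expansion of the difference has no term in [z ^ m] alone; replacing each remaining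
    term by its modulus gives the right side. *)
Lemma normc_exprDB (z w : C) m :
  normc ((z + w) ^+ m - z ^+ m) <= (normc z + normc w) ^+ m - normc z ^+ m.
Proof.
elim: m => [|m IH]; first by rewrite !expr0 !subrr normc0.
have -> : (z + w) ^+ m.+1 - z ^+ m.+1 =
   (z + w) * ((z + w) ^+ m - z ^+ m) + w * z ^+ m by rewrite !exprS; ring.
apply: le_trans (ler_normcD _ _) _; rewrite !normcM normcX.
have h1 : normc (z + w) * normc ((z + w) ^+ m - z ^+ m) <=
   (normc z + normc w) * ((normc z + normc w) ^+ m - normc z ^+ m).
  by apply: ler_pM; rewrite ?normc_ge0// ler_normcD.
apply: le_trans (lerD h1 (lexx _)) _.
by rewrite !exprS le_eqVlt; apply/orP; left; apply/eqP; ring.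
Qed.

(** The condition reads [|d| / c <= x / m] with [x = 13 / 20], a value just below [ln 2]. Then
    [(c + i d) ^ m] is within [c ^ m (exp x - 1) < c ^ m] of the positive number [c ^ m]. *)
Lemma Re_exprn_gt0 (c d : R) m : 0 < c -> 20 * (m%:R * `|d|) <= 13 * c ->
  0 < Re (Complex c d ^+ m).
Proof.
move=> c0 dc.
have [->|m0] := eqVneq m 0; first by rewrite expr0 /= ltr01.
have mp : 0 < m%:R :> R by rewrite ltr0n lt0n.
pose x : R := 13 / 20.
have d1 : `|d| <= c * (x / m%:R).
  by rewrite mulrA ler_pdivlMr// /x; lra.
have -> : Complex c d = c%:C + Complex 0 d.
  by apply/eqP; rewrite eq_complex/= addr0 add0r !eqxx.
set w := Complex 0 d.
have nw : normc w = `|d| by rewrite /w /= expr0n add0r sqrtr_sqr.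
have h := le_trans (normc_ge_absRe _) (normc_exprDB c%:C w m).
move: h; rewrite ReD ReN -rmorphXn normc_realc nw (gtr0_norm c0).
rewrite -[Re (c ^+ m)%:C]/(c ^+ m).
rewrite ler_norml => /andP[h _].
suff : (c + `|d|) ^+ m < 2 * c ^+ m by move: h; set A := _ ^+ m; lra.
apply: (@le_lt_trans _ _ (c ^+ m * expR x)).
  apply: (@le_trans _ _ ((c * expR (x / m%:R)) ^+ m)).
    apply: lerXn2r; rewrite ?nnegrE ?addr_ge0 ?mulr_ge0 ?expR_ge0 ?(ltW c0)//.
    have := ler_wpM2l (ltW c0) (expR_ge1Dx (x / m%:R)).
    by apply: le_trans; rewrite mulrDr mulr1 lerD2l.
  by rewrite exprMn -expRM_natl [m%:R * _]mulrC divfK// gt_eqF.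
rewrite mulrC ltr_pM2r ?exprn_gt0//.
(* [exp x < 2] is checked as [exp (- x) >= (1 - x / 8) ^ 8 > 1 / 2]. *)
have h8 : 1 - x / 8 <= expR (- (x / 8)) by have := expR_ge1Dx (- (x / 8)); lra.
have : (1 - x / 8) ^+ 8 <= expR (- x).
  have -> : - x = 8%:R * (- (x / 8)) by rewrite /x; lra.
  rewrite expRM_natl; apply: lerXn2r; rewrite ?nnegrE ?expR_ge0// /x; lra.
have : 2^-1 < (1 - x / 8) ^+ 8 by rewrite /x; lra.
move=> a1 a2; have := lt_le_trans a1 a2.
by rewrite expRN ltf_pV2 ?posrE ?expR_gt0.
Qed.

(** For [|x| <= 1 / 5] one has [x - x ^ 2 <= ln (1 + x) <= x]; take [x = y / m] and multiply by [m],
    the quadratic term being then at most [a ^ 2 / m]. *)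
Lemma exprn1D_expR (y a : R) m : `|y| <= a -> 5 * a <= m%:R -> (0 < m)%N ->
  expR (y - a ^+ 2 / m%:R) <= (1 + y / m%:R) ^+ m <= expR y.
Proof.
move=> ya am m0.
have mp : 0 < m%:R :> R by rewrite ltr0n.
set x := y / m%:R; have yE : y = m%:R * x by rewrite /x mulrC divfK// gt_eqF.
have x5 : `|x| <= 5^-1.
  rewrite /x normrM normfV (gtr0_norm mp) ler_pdivrMr//; lra.
have x5' : - 5^-1 <= x <= 5^-1 by rewrite -ler_norml.
have x2 : x ^+ 2 * m%:R <= a ^+ 2 / m%:R.
  have -> : x ^+ 2 * m%:R = y ^+ 2 / m%:R by rewrite /x; field; rewrite gt_eqF.
  rewrite ler_pM2r ?invr_gt0// -[y ^+ 2]real_normK ?num_real//.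
  by apply: lerXn2r; rewrite ?nnegrE// (le_trans _ ya).
have e0 : expR (x - x ^+ 2) <= 1 + x.
  have [x0|x0] := leP 0 x.
    have := expR_ge1Dx (x ^+ 2 - x).
    rewrite -[x - _]opprB expRN => h.
    rewrite -div1r ler_pdivrMr ?expR_gt0//.
    by apply: le_trans (ler_wpM2l _ h); nra.
  have := expR_ge1Dx ((x ^+ 2 - x) / 2) => h.
  have h2 : (1 + (x ^+ 2 - x) / 2) ^+ 2 <= expR (x ^+ 2 - x).
    have -> : x ^+ 2 - x = 2%:R * ((x ^+ 2 - x) / 2) by lra.
    rewrite expRM_natl; apply: lerXn2r; rewrite ?nnegrE ?expR_ge0//; nra.
  rewrite -[x - _]opprB expRN -div1r ler_pdivrMr ?expR_gt0//.
  apply: le_trans (ler_wpM2l _ h2); last by lra.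
  have -> : (1 + x) * (1 + (x ^+ 2 - x) / 2) ^+ 2 =
     1 + x ^+ 2 * (x + (1 + x) * (1 - x) ^+ 2 / 4) by field.
  rewrite lerDl mulr_ge0 ?sqr_ge0//; nra.
apply/andP; split.
  apply: (@le_trans _ _ (expR (x - x ^+ 2) ^+ m)).
    by rewrite -expRM_natl ler_expR yE; lra.
  by apply: lerXn2r; rewrite ?nnegrE ?expR_ge0//; lra.
rewrite yE expRM_natl; apply: lerXn2r; rewrite ?nnegrE ?expR_ge0//; first by lra.
exact: expR_ge1Dx.
Qed.

End power_estimates.

(** * Polynomial approximation of the log-Laplace transform *)

Section positive_functional.
Variable R : realType.
Local Notation C := (complex R).
Local Notation Re := (@complex.Re R).
Local Notation Im := (@complex.Im R).
Local Notation "x %:C" := (real_complex R x).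
Implicit Types (f g : R -> R) (I : (R -> R) -> R).

(** What the approximation retains of integration with weight [exp (- kappa)] against a measure
    carried by [[-b, b]]. A real-valued [I] avoids complex integrals: real parts of polynomials are
    integrated instead. Strict positivity in the last clause is what excludes zeros. *)
Definition pos_functional (b : R) I : Prop :=
  [/\ forall (c : R) f g, continuous f -> continuous g ->
        I (fun s => c * f s + g s) = c * I f + I g,
      forall f g, continuous f -> continuous g ->
        (forall s, `|s| <= b -> f s <= g s) -> I f <= I g
    & forall f, continuous f -> (forall s, `|s| <= b -> 0 < f s) -> 0 < I f].

Lemma continuous_sum_monomials n (c : nat -> R) :
  continuous (fun s : R => \sum_(k < n) c k * s ^+ k).
Proof.
rewrite (_ : (fun s : R => _) = horner (\poly_(k < n) c k)).
  exact: continuous_horner.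
by apply/funext => s; rewrite horner_poly.
Qed.

Lemma pos_functional0 b I : pos_functional b I -> I (fun=> 0) = 0.
Proof.
move=> [Ilin _ _]; have c0 : continuous (fun _ : R => 0 : R) by exact: cst_continuous.
rewrite -[RHS](addNr (I (fun=> 0))) -mulN1r -(Ilin (-1) _ _ c0 c0).
by congr I; apply/funext => s; rewrite mulr0 addr0.
Qed.

Lemma pos_functional_poly b I n (c : nat -> R) : pos_functional b I ->
  I (fun s => \sum_(k < n) c k * s ^+ k) =
  \sum_(k < n) c k * I (fun s => s ^+ k).
Proof.
move=> Ip; have [Ilin _ _] := Ip.
have cX k : continuous (fun s : R => s ^+ k) by move=> s; exact: exprn_continuous.
have cs k := @continuous_sum_monomials k c.
elim: n => [|n IH].
  rewrite big_ord0 (_ : (fun s => _) = (fun=> 0)) ?(pos_functional0 Ip)//.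
  by apply/funext => s; rewrite big_ord0.
rewrite big_ord_recr/= -IH addrC -Ilin//; congr I; apply/funext => s.
by rewrite big_ord_recr addrC.
Qed.

(** The first error term comes from replacing [exp] by an [m]-th power, through the sandwich of
    [exprn1D_expR]; the second is that of [ln_poly_approx] for the resulting polynomial, of degree
    at most [m]. The bound [64 a ^ 2 <= m] keeps the base of the power near 1 on the ellipse. *)
Lemma ln_laplace_approx b I (A : R) (m N : nat) :
  pos_functional b I -> 0 < A -> 0 < b -> 1 <= A * b ->
  64 * (A * b) ^+ 2 <= m%:R ->
  let r := (1 - (4 * (A * b))^-1) ^+ 2 in
  exists2 q : {poly R}, (size q <= N.+1)%N &
    forall x, `|x| <= A ->
      `|ln (I (fun s => expR (s * x))) - q.[x]|
        <= (A * b) ^+ 2 / m%:R + m%:R * (2 * r ^+ N.+1 / (1 - r)).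
Proof.
move=> Ip A0 b0; set a := A * b => a1 am r.
have [Ilin Ile Ipos] := Ip.
have m0 : 0 < m%:R :> R by apply: lt_le_trans am; nra.
have mn0 : (0 < m)%N by rewrite -(ltr0n R).
pose h := (4 * a)^-1.
have ha : 4 * (a * h) = 1 by rewrite mulrA divff//; lra.
have h0 : 0 < h by rewrite invr_gt0; lra.
have h4 : h <= 4^-1 by rewrite lef_pV2 ?posrE; lra.
have rE : r = (1 - h) ^+ 2 by [].
have r01 : 0 < r < 1 by apply/andP; split; rewrite rE; nra.
have /andP[r0 r1] := r01.
have rV : r^-1 * r = 1 by rewrite mulVf// gt_eqF.
have ell1 : (r + r^-1) / 2 <= 3 / 2.
  have : r^-1 <= 16 / 9.
    by rewrite -div1r ler_pdivrMr// rE; nra.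
  lra.
(* [5 / 8] stays below [13 / 20] times [39 / 40]: the threshold of [Re_exprn_gt0] with the lower
   bound [c1] on the real part. *)
have ell2 : a * ((r^-1 - r) / 2) <= 5 / 8.
  have : r^-1 - r <= 5 * h.
    rewrite lerBlDr -div1r ler_pdivrMr// rE.
    suff : 0 <= h * (1 - 4 * h + h ^+ 2 + h ^+ 3) by lra.
    by rewrite mulr_ge0 ?(ltW h0)//; nra.
  nra.
have m64 : 64 * a <= m%:R by nra.
have m64' : 64 * (a / m%:R) <= 1 by rewrite mulrA ler_pdivrMr ?mul1r.
(* [w k (u ^ k)] is the coefficient of [s ^ k] in [(1 + s A u / m) ^ m]. Letting [I] act on the
   monomials in [s] turns this power into a polynomial in [u] whose coefficients are scaled
   moments. *)
pose w k (u : R) := 'C(m, k)%:R * (A / m%:R) ^+ k * u.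
pose P := \poly_(k < m.+1) w k (I (fun s => s ^+ k)).
have rE1 (u : R) : (fun s : R => (1 + s * (A * u) / m%:R) ^+ m) =
    (fun s => \sum_(k < m.+1) w k (u ^+ k) * s ^+ k).
  apply/funext => s; rewrite exprDn; apply: eq_bigr => k _.
  rewrite expr1n mul1r -mulr_natl /w.
  have -> : s * (A * u) / m%:R = A / m%:R * u * s by ring.
  by rewrite !exprMn; ring.
have cE1 (z : C) : (fun s : R => Re ((1 + (s * (A / m%:R))%:C * z) ^+ m)) =
    (fun s => \sum_(k < m.+1) w k (Re (z ^+ k)) * s ^+ k).
  apply/funext => s; rewrite exprDn Re_sum; apply: eq_bigr => k _.
  rewrite expr1n mul1r -mulr_natl exprMn -rmorphXn mulrA.
  rewrite -[X in X * _ * _](rmorph_nat (real_complex R)) -rmorphM ReZ /w exprMn.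
  by ring.
have PE (u : R) : P.[u] = I (fun s => (1 + s * (A * u) / m%:R) ^+ m).
  rewrite horner_poly rE1 (pos_functional_poly _ (fun k => w k (u ^+ k)) Ip).
  by apply: eq_bigr => k _; rewrite /w; ring.
(* [I] acts on real functions, so only the real part of [P] at a complex point is expressed through
   it; positivity of that part is enough to exclude a zero. *)
have PCE (z : C) : Re (map_poly (real_complex R) P).[z] =
    I (fun s => Re ((1 + (s * (A / m%:R))%:C * z) ^+ m)).
  rewrite cE1 (pos_functional_poly _ (fun k => w k (Re (z ^+ k))) Ip).
  have szP : (size (map_poly (real_complex R) P) <= m.+1)%N.
    by rewrite size_map_poly size_poly.
  rewrite (horner_coef_wide _ szP) Re_sum; apply: eq_bigr => k _.
  by rewrite coef_map coef_poly ltn_ord ReZ /w; ring.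
have cRe (z : C) : continuous (fun s : R => Re ((1 + (s * (A / m%:R))%:C * z) ^+ m)).
  by rewrite cE1; exact: (@continuous_sum_monomials _ (fun k => w k (Re (z ^+ k)))).
have hp (z : C) : ellipse r z -> (map_poly (real_complex R) P).[z] != 0.
  move=> [z1 z2]; suff : 0 < Re (map_poly (real_complex R) P).[z].
    by move=> Re0; apply/eqP => e; move: Re0; rewrite e ltxx.
  rewrite PCE; apply: Ipos => // s sb.
  have -> : 1 + (s * (A / m%:R))%:C * z =
     Complex (1 + s * (A / m%:R) * Re z) (s * (A / m%:R) * Im z).
    by case: (z) => x y; apply/eqP; rewrite eq_complex/= !mul0r subr0 addr0 add0r !eqxx.
  have sA : `|s * (A / m%:R)| <= a / m%:R.
    rewrite mulrA normrM [X in _ * X]gtr0_norm ?invr_gt0// ler_pM2r ?invr_gt0//.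
    by rewrite normrM (gtr0_norm A0) /a mulrC ler_pM2l.
  have c1 : 39 / 40 <= 1 + s * (A / m%:R) * Re z.
    have : `|s * (A / m%:R) * Re z| <= 64^-1 * (3 / 2).
      rewrite normrM; apply: ler_pM => //; last exact: le_trans ell1.
      by apply: le_trans sA _; lra.
    rewrite ler_norml; lra.
  apply: Re_exprn_gt0; first by lra.
  suff : m%:R * `|s * (A / m%:R) * Im z| <= 5 / 8 by lra.
  apply: le_trans ell2; rewrite normrM [m%:R * (_ * _)]mulrA.
  apply: ler_pM; rewrite ?mulr_ge0//.
  by rewrite mulrC -ler_pdivlMr.
have [q sq hq] := ln_poly_approx (m := m) N r01 (size_poly _ _) hp.
(* The factorization took place in the variable [u = x / A], which ranges over [[-1, 1]]. *)
exists (q \Po (A^-1 *: 'X)).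
  apply: leq_trans (size_comp_poly_leq _ _) _.
  rewrite ltnS (size_scale _ (invr_neq0 (lt0r_neq0 A0))) size_polyX muln1.
  by case: (size q) sq.
move=> x xA; pose u := x / A.
have xE : x = A * u by rewrite /u mulrC divfK// gt_eqF.
have u1 : -1 <= u <= 1.
  by rewrite -ler_norml /u normrM normfV (gtr0_norm A0) ler_pdivrMr// mul1r.
rewrite horner_comp hornerZ hornerX mulrC -/u.
set l := I _.
have ce : continuous (fun s : R => expR (s * x)).
  move=> s; apply: (cvg_comp (fun s : R => s * x) expR).
    by apply: cvgM; [exact: cvg_id|exact: cvg_cst].
  exact: continuous_expR.
have c0 : continuous (fun _ : R => 0 : R) by exact: cst_continuous.
have cp : continuous (fun s : R => (1 + s * (A * u) / m%:R) ^+ m).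
  by rewrite rE1; exact: (@continuous_sum_monomials _ (fun k => w k (u ^+ k))).
have l0 : 0 < l by apply: Ipos => // s _; exact: expR_gt0.
have bnd s : `|s| <= b -> expR (s * x - a ^+ 2 / m%:R) <= (1 + s * (A * u) / m%:R) ^+ m <= expR (s * x).
  move=> sb; rewrite -xE; apply: exprn1D_expR => //; last lra.
  by rewrite normrM /a mulrC; apply: ler_pM.
have Pl : P.[u] <= l by rewrite PE; apply: Ile => // s /bnd /andP[].
have lP : expR (- (a ^+ 2 / m%:R)) * l <= P.[u].
  have := Ilin (expR (- (a ^+ 2 / m%:R))) _ _ ce c0.
  rewrite (pos_functional0 Ip).
  rewrite addr0 => <-; rewrite PE; apply: Ile => //.
    move=> s; apply: cvgD; last exact: cvg_cst.
    by apply: cvgM; [exact: cvg_cst|exact: ce].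
  by move=> s /bnd /andP[+ _]; rewrite addr0 expRD mulrC.
have P0 : 0 < P.[u] by apply: lt_le_trans lP; rewrite mulr_gt0 ?expR_gt0.
have := hq u u1; rewrite (gtr0_norm P0) => hqu.
have -> : ln l - q.[u] = (ln l - ln P.[u]) + (ln P.[u] - q.[u]) by ring.
apply: le_trans (ler_normD _ _) _; apply: lerD => //.
have e1 : ln P.[u] <= ln l by rewrite ler_ln.
rewrite ger0_norm ?subr_ge0//.
have : ln (expR (- (a ^+ 2 / m%:R)) * l) <= ln P.[u].
  by rewrite ler_ln ?posrE// mulr_gt0 ?expR_gt0.
by rewrite lnM ?posrE ?expR_gt0// expRK; lra.
Qed.
End positive_functional.

(** * Gaussian quadrature *)

Section finite_quadrature.
Variable R : realType.
Implicit Types (s : seq R) (q : R -> R) (x : nat -> R) (p : {poly R}).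

Lemma quadrature_exact s q x n J p :
  (forall k, (k <= (2 * J).-1)%N ->
    \sum_(t <- s) q t * t ^+ k = n%:R^-1 * \sum_(i < n) x i ^+ k) ->
  (0 < J)%N -> (size p <= 2 * J)%N ->
  \sum_(t <- s) q t * p.[t] = n%:R^-1 * \sum_(i < n) p.[x i].
Proof.
move=> mom J0 sp.
under eq_bigr do rewrite (horner_coef_wide _ sp) mulr_sumr.
under [in RHS]eq_bigr do rewrite (horner_coef_wide _ sp).
rewrite exchange_big [in RHS]exchange_big mulr_sumr; apply: eq_bigr => k _ /=.
rewrite -mulr_sumr mulrCA -mom; last first.
  by rewrite -ltnS prednK ?ltn_ord// muln_gt0.
by rewrite mulr_sumr; apply: eq_bigr => t _; rewrite mulrCA.
Qed.

(* Test the rule on [W = \prod_(t != t0) (X - t)^2] and on [(t0 - X) W]. *)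
Lemma quadrature_node_le s q x n J (A t0 : R) :
  (forall p, (size p <= 2 * J)%N ->
    \sum_(t <- s) q t * p.[t] = n%:R^-1 * \sum_(i < n) p.[x i]) ->
  uniq s -> (size s <= J)%N -> (forall i, (i < n)%N -> x i <= A) ->
  t0 \in s -> 0 < q t0 -> t0 <= A.
Proof.
move=> ex us sJ xA t0s qt0; rewrite leNgt; apply/negP => At0.
(* Squares make [W] nonnegative, and its degree, twice the number of other nodes, leaves room for
   one linear factor within the exactness range. *)
pose W : {poly R} := \prod_(t <- rem t0 s) ('X - t%:P) ^+ 2.
have srem : (size (rem t0 s)).+1 = size s.
  by rewrite size_rem// prednK//; case: (s) t0s.
have sW : size W = (2 * size (rem t0 s)).+1.
  rewrite /W; elim: (rem t0 s) => [|t l IH]; first by rewrite big_nil size_poly1.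
  rewrite big_cons size_monicM; first last.
  - by rewrite -size_poly_gt0 IH.
  - by rewrite monic_exp// monicXsubC.
  by rewrite IH size_exp_XsubC addSn addnS/= mulnS add2n.
have WE y : W.[y] = \prod_(t <- rem t0 s) (y - t) ^+ 2.
  by rewrite horner_prod; apply: eq_bigr => t _; rewrite !hornerE.
have W_ge0 y : 0 <= W.[y] by rewrite WE prodr_ge0// => t _; rewrite sqr_ge0.
have Wt0 : 0 < W.[t0].
  rewrite lt_neqAle W_ge0 andbT eq_sym WE prodf_seq_neq0; apply/allP => t /=.
  rewrite mem_rem_uniq// inE => /andP[tt0 _]; rewrite expf_eq0/= subr_eq0.
  by rewrite eq_sym.
have W0 t : t \in rem t0 s -> W.[t] = 0.
  move=> ts; rewrite WE; apply/eqP; rewrite prodf_seq_eq0; apply/hasP.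
  by exists t => //=; rewrite subrr expr0n.
have s2J : (2 * size (rem t0 s) + 2 <= 2 * J)%N by rewrite addnC -mulnS srem leq_mul2l.
have exW : q t0 * W.[t0] = n%:R^-1 * \sum_(i < n) W.[x i].
  rewrite -ex; last by rewrite sW (leq_trans _ s2J)// addn2.
  rewrite (perm_big _ (perm_to_rem t0s)) big_cons/= big1_seq ?addr0// => t /andP[_].
  by move=> /W0 ->; rewrite mulr0.
have exV : 0 = n%:R^-1 * \sum_(i < n) (t0 - x i) * W.[x i].
  have -> : \sum_(i < n) (t0 - x i) * W.[x i] =
      \sum_(i < n) ((t0%:P - 'X) * W).[x i].
    by apply: eq_bigr => i _; rewrite hornerM !hornerE.
  rewrite -ex; last first.
    apply: leq_trans (size_polyMleq _ _) _; rewrite sW.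
    rewrite -opprB size_polyN size_XsubC; lia.
  rewrite big1_seq// => t /andP[_ ts]; rewrite hornerM.
  have [->|tt0] := eqVneq t t0; first by rewrite hornerD hornerC hornerN hornerX subrr mul0r mulr0.
  by rewrite W0 ?mulr0// mem_rem_uniq// inE tt0.
(* Since [t0 - x i >= t0 - A], the vanishing mean of [(t0 - x i) W] is at least [t0 - A] times the
   mean of [W]; but the latter is [q t0 W(t0) > 0]. *)
have : (t0 - A) * (n%:R^-1 * \sum_(i < n) W.[x i]) <= 0.
  rewrite [leRHS]exV mulrCA ler_wpM2l ?invr_ge0// mulr_sumr; apply: ler_sum => i _.
  by rewrite ler_wpM2r// lerB// xA.
by rewrite -exW leNgt !mulr_gt0// subr_gt0.
Qed.

(** The lower bound is [quadrature_node_le] for the reflected rule and data. *)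
Lemma quadrature_node_bound s q x n J (A t0 : R) : (0 < J)%N ->
  (forall k, (k <= (2 * J).-1)%N ->
    \sum_(t <- s) q t * t ^+ k = n%:R^-1 * \sum_(i < n) x i ^+ k) ->
  uniq s -> (size s <= J)%N -> (forall i, (i < n)%N -> `|x i| <= A) ->
  t0 \in s -> 0 < q t0 -> `|t0| <= A.
Proof.
move=> J0 mom us sJ xA t0s qt0; rewrite ler_norml; apply/andP; split; last first.
  apply: (@quadrature_node_le s q x n J) => //.
    by move=> p; exact: quadrature_exact.
  by move=> i /xA; rewrite ler_norml => /andP[].
rewrite lerNl.
apply: (@quadrature_node_le (map -%R s) (q \o -%R) (fun i => - x i) n J) => //.
- move=> p sp; rewrite big_map.
  have -> : \sum_(i < n) p.[- x i] = \sum_(i < n) (p \Po (- 'X)).[x i].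
    by apply: eq_bigr => i _; rewrite horner_comp hornerN hornerX.
  rewrite -(quadrature_exact mom J0).
    by apply: eq_bigr => t _; rewrite /= opprK horner_comp hornerN hornerX.
  by rewrite size_comp_poly2 ?size_polyN ?size_polyX.
- by rewrite map_inj_uniq//; exact: oppr_inj.
- by rewrite size_map.
- by move=> i /xA; rewrite ler_norml => /andP[]; rewrite lerNl.
- by rewrite map_f.
- by rewrite /= opprK.
Qed.

(** [p1 - p2] is within [2 e] of [f1 - f2] on [[-A, A]], which contains the data and every node of
    positive weight. The error is paid once at the data and once at the nodes; the rule carries the
    polynomial from one to the other, and at the nodes [f2] does at least as well as [f1]. *)
Lemma quadrature_comparison s q x n J (A e : R) (f1 f2 : R -> R) (p1 p2 : {poly R}) :
  (0 < n)%N -> (0 < J)%N ->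
  (forall k, (k <= (2 * J).-1)%N ->
    \sum_(t <- s) q t * t ^+ k = n%:R^-1 * \sum_(i < n) x i ^+ k) ->
  uniq s -> (size s <= J)%N -> (forall i, (i < n)%N -> `|x i| <= A) ->
  (forall t, 0 <= q t) ->
  (size p1 <= 2 * J)%N -> (size p2 <= 2 * J)%N ->
  (forall y, `|y| <= A -> `|f1 y - p1.[y]| <= e) ->
  (forall y, `|y| <= A -> `|f2 y - p2.[y]| <= e) ->
  \sum_(t <- s) q t * f1 t <= \sum_(t <- s) q t * f2 t ->
  \sum_(i < n) f1 (x i) - \sum_(i < n) f2 (x i) <= 4 * e * n%:R.
Proof.
move=> n0 J0 mom us sJ xA q0 sp1 sp2 h1 h2 f12.
have np : 0 < n%:R :> R by rewrite ltr0n.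
pose p := p1 - p2.
have sp : (size p <= 2 * J)%N.
  by rewrite (leq_trans (size_polyD _ _))// geq_max sp1 size_polyN.
have exP := quadrature_exact mom J0 sp.
have q1 : \sum_(t <- s) q t = 1.
  have := mom 0; under eq_bigr do rewrite expr0 mulr1.
  move=> ->//; under eq_bigr do rewrite expr0.
  by rewrite sumr_const card_ord mulVf ?gt_eqF.
have b y : `|y| <= A -> - (2 * e) <= f1 y - f2 y - p.[y] <= 2 * e.
  move=> yA; move: (h1 _ yA) (h2 _ yA); rewrite /p hornerD hornerN !ler_norml.
  by move=> /andP[? ?] /andP[? ?]; apply/andP; split; lra.
have lP : \sum_(i < n) f1 (x i) - \sum_(i < n) f2 (x i) <= \sum_(i < n) p.[x i] + 2 * e * n%:R.
  have -> : 2 * e * n%:R = \sum_(i < n) 2 * e by rewrite sumr_const card_ord mulr_natr.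
  rewrite -sumrB -big_split; apply: ler_sum => i _ /=.
  by have /andP[] := b _ (xA _ (ltn_ord i)); lra.
have lQ : \sum_(t <- s) q t * p.[t] <= 2 * e.
  apply: (@le_trans _ _ (\sum_(t <- s) (q t * f1 t - q t * f2 t + q t * (2 * e)))).
    rewrite big_seq [leRHS]big_seq; apply: ler_sum => t ts.
    have [qt|qt] := ltP 0 (q t); last first.
      have -> : q t = 0 by apply/eqP; rewrite eq_le qt q0.
      by rewrite !mul0r subrr addr0.
    have tA := quadrature_node_bound J0 mom us sJ xA ts qt.
    by have /andP[] := b _ tA; nra.
  by rewrite big_split sumrB -mulr_suml q1 /=; lra.
have : \sum_(i < n) p.[x i] = n%:R * \sum_(t <- s) q t * p.[t].
  by rewrite exP mulVKf// gt_eqF.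
nra.
Qed.

End finite_quadrature.

(** * Choice of the power and of the constant 100 *)

Section approximation_error.
Variable R : realType.

(** [X] stands for [n ^ (1 + gamma)], and the factor 4 is that of [quadrature_comparison]. With [m]
    about [64 a ^ 2 X], the first term is at most [1 / (64 X)]. As [J >= 2 a ln L], one has
    [r ^ (2 J) <= exp (- J / a) <= L ^ -2]; then [L >= 100 X a ^ 2] and [1 / (1 - r) <= 4 a] bring
    the second term below [(13 / 250) / X]. *)
Lemma approximation_error_bound (a X K : R) (J : nat) :
  1 <= a -> 1 <= X -> 0 <= K ->
  2 * a * ln (100 * X * a * (a + K)) <= J%:R ->
  exists2 m : nat, 64 * a ^+ 2 <= m%:R &
  let r := (1 - (4 * a)^-1) ^+ 2 in
  4 * (a ^+ 2 / m%:R + m%:R * (2 * r ^+ (2 * J) / (1 - r))) <= X^-1.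
Proof.
move=> a1 X1 K0 hJ.
pose y : R := 64 * a ^+ 2 * X.
have y1 : 1 <= y by rewrite /y; nra.
pose m := Num.trunc y; exists m.+1.
  have := truncnS_gt y; rewrite -/m => ym.
  by apply: le_trans (ltW ym); rewrite /y; nra.
have mlo : y <= m.+1%:R by rewrite ltW// truncnS_gt.
have mhi : m.+1%:R <= 65 * a ^+ 2 * X.
  have : m%:R <= y by rewrite truncn_le; lra.
  rewrite -natr1 /y; nra.
move=> r; pose h := (4 * a)^-1.
have ha : 4 * (a * h) = 1 by rewrite mulrA divff//; lra.
have h0 : 0 < h by rewrite invr_gt0; lra.
have h4 : h <= 4^-1 by rewrite lef_pV2 ?posrE; lra.
have rE : r = (1 - h) ^+ 2 by [].
pose L := 100 * X * a * (a + K).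
have L1 : 100 * X * a ^+ 2 <= L by rewrite /L expr2; nra.
have L0 : 0 < L by apply: lt_le_trans L1; nra.
have rJ : r ^+ (2 * J) <= L ^- 2.
  have e1 : 1 - h <= expR (- h) by have := expR_ge1Dx (- h); lra.
  rewrite rE -exprM mulnA.
  apply: (@le_trans _ _ (expR (- h) ^+ (2 * 2 * J))).
    by apply: lerXn2r; rewrite ?nnegrE ?expR_ge0//; lra.
  rewrite -expRM_natl -(@lnK _ (L ^- 2)) ?posrE ?invr_gt0 ?exprn_gt0//.
  rewrite ler_expR lnV ?posrE ?exprn_gt0// lnXn// mulr2n.
  have : 2 * ln L <= 4 * h * J%:R.
    have := ler_wpM2l (ltW h0) hJ; rewrite -/L.
    have -> : h * (2 * a * ln L) = 4 * (a * h) * ln L / 2 by field.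
    rewrite ha; lra.
  rewrite !natrM; lra.
have r1 : h <= 1 - r by rewrite rE; nra.
have X0 : 0 < X by lra.
have hV : h^-1 = 4 * a by rewrite /h invrK.
have f1 : a ^+ 2 / m.+1%:R <= (64 * X)^-1.
  rewrite ler_pdivrMr ?ltr0n//.
  apply: le_trans (ler_wpM2l _ mlo); last by rewrite invr_ge0; lra.
  rewrite /y le_eqVlt; apply/orP; left; apply/eqP; field; lra.
have L2 : L ^- 2 <= (100 * X * a ^+ 2) ^- 2.
  rewrite lef_pV2 ?posrE ?exprn_gt0//; last by nra.
  by apply: lerXn2r; rewrite ?nnegrE ?(ltW L0)//; nra.
have f2 : m.+1%:R * (2 * r ^+ (2 * J) / (1 - r)) <=
   65 * a ^+ 2 * X * (2 * (100 * X * a ^+ 2) ^- 2 * (4 * a)).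
  apply: ler_pM => //.
    rewrite divr_ge0//; last by lra.
    by rewrite mulr_ge0// exprn_ge0// rE sqr_ge0.
  apply: ler_pM => //.
  - by rewrite mulr_ge0// exprn_ge0// rE sqr_ge0.
  - by rewrite invr_ge0; lra.
  - by rewrite ler_pM2l// (le_trans rJ).
  - by rewrite -hV lef_pV2 ?posrE//; lra.
have f3 : 65 * a ^+ 2 * X * (2 * (100 * X * a ^+ 2) ^- 2 * (4 * a)) =
   (13 / 250) * (X^-1 * a^-1) by field; rewrite !gt_eqF//; lra.
have f4 : X^-1 * a^-1 <= X^-1.
  by rewrite ler_piMr ?invr_ge0 ?(ltW X0)// invf_le1//; lra.
have f5 : (64 * X)^-1 = X^-1 / 64 by field; rewrite gt_eqF.
have X0' : 0 < X^-1 by rewrite invr_gt0.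
move: f1 f2 f4 X0'; rewrite f5 f3.
move: (a ^+ 2 / m.+1%:R) (m.+1%:R * _) (X^-1 * a^-1) (X^-1) => u v w z.
lra.
Qed.

End approximation_error.

(** * Partition function and mixtures *)

Section convex_measurability.
Variable R : realType.
Implicit Types (m : measureR R) (D : set (Borel R)).

Lemma expR_convex (a b t : R) : 0 <= t <= 1 ->
  expR (t * a + (1 - t) * b) <= t * expR a + (1 - t) * expR b.
Proof.
move=> /andP[t0 t1]; set c := t * a + (1 - t) * b.
have tangent (x : R) : expR c * (1 + (x - c)) <= expR x.
  have -> : expR x = expR c * expR (x - c) by rewrite -expRD subrKC.
  by rewrite ler_pM2l ?expR_gt0// expR_ge1Dx.
have h1 := ler_wpM2l t0 (tangent a).
have h2 : (1 - t) * (expR c * (1 + (b - c))) <= (1 - t) * expR b.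
  by rewrite ler_wpM2l// subr_ge0.
have -> : expR c = t * (expR c * (1 + (a - c))) + (1 - t) * (expR c * (1 + (b - c))).
  by rewrite /c; ring.
exact: lerD.
Qed.

Lemma sublevel_interval_measurable (F : R -> \bar R) :
  (forall c, is_interval [set t | (F t < c%:E)%E]) ->
  measurable_fun [set: Borel R] (F : Borel R -> \bar R).
Proof.
move=> hF; apply: (measurability _ (ErealGenCInfty.measurableE R)) => //.
move=> _ [_ [x ->] <-]; apply: measurableI => //.
rewrite (_ : _ @^-1` _ = ~` [set t | (F t < x%:E)%E]).
  by apply: measurableC; apply: is_interval_measurable; exact: hF.
by apply/seteqP; split => t /=; rewrite in_itv/= andbT leNgt => /negP.
Qed.

(* The integral is convex in [t], so its sublevel sets are intervals; Fubini is
   not available as [m] need not be sigma-finite. *)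
Lemma exp_integral_measurable m D (w u : Borel R -> R) : measurable D ->
  measurable_fun D w -> measurable_fun D u -> (forall x, D x -> 0 <= w x) ->
  measurable_fun [set: Borel R]
    (fun t : Borel R => \int[m]_(x in D) (expR (t * u x) * w x)%:E)%E.
Proof.
have key (k c A B : R) : 0 <= k -> k <= 1 -> A < c -> B < c -> k * A + (1 - k) * B < c.
  move=> k0 k1 Ac Bc; have [k0'|k0'] := ltP 0 k; first nra.
  have k_eq0 : k = 0 by lra.
  by rewrite k_eq0; lra.
move=> mD mw mu w0; apply: sublevel_interval_measurable => c s t /= Fs Ft y /andP[sy yt].
have mE' (z : R) : measurable_fun D (fun x => expR (z * u x) * w x).
  apply: measurable_funM => //.
  by apply: measurableT_comp => //; exact: measurable_funM.
have mE (z : R) : measurable_fun D (fun x => (expR (z * u x) * w x)%:E).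
  exact/measurable_EFinP.
have mK (z k : R) : measurable_fun D (fun x => k * (expR (z * u x) * w x)).
  exact: (measurable_funM (@measurable_cst _ _ _ _ D k) (mE' z)).
have mKE (z k : R) : measurable_fun D (fun x => (k * (expR (z * u x) * w x))%:E).
  exact/measurable_EFinP.
have E0 (z k : R) x : 0 <= k -> D x -> (0 <= (k * (expR (z * u x) * w x))%:E)%E.
  by move=> k0 Dx; rewrite lee_fin !mulr_ge0// ?expR_ge0// w0.
have E0' (z : R) x : D x -> (0 <= (expR (z * u x) * w x)%:E)%E.
  by move=> Dx; rewrite -[_ * _]mul1r E0.
have [ts|st] := leP t s.
  by have -> : y = t by apply/eqP; rewrite eq_le yt (le_trans ts sy).
pose k := (t - y) / (t - s).
have k01 : 0 <= k <= 1.
  rewrite divr_ge0 ?subr_ge0 ?(ltW st)//= ler_pdivrMr ?subr_gt0// mul1r lerB//.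
have /andP[k0 k1] := k01.
have yE : y = k * s + (1 - k) * t by rewrite /k; field; rewrite subr_eq0 gt_eqF.
apply: (@le_lt_trans _ _ (\int[m]_(x in D) (k * (expR (s * u x) * w x)
    + (1 - k) * (expR (t * u x) * w x))%:E)%E).
  apply: ge0_le_integral => //.
  - by move=> x; exact: E0'.
  - by apply/measurable_EFinP; exact: (measurable_funD (mK s k) (mK t (1 - k))).
  - move=> x Dx; rewrite lee_fin.
    have -> : y * u x = k * (s * u x) + (1 - k) * (t * u x) by rewrite yE; ring.
    apply: le_trans (ler_wpM2r (w0 _ Dx) (expR_convex (s * u x) (t * u x) k01)) _.
    by rewrite [leLHS]mulrDl -!mulrA.
under eq_integral do rewrite EFinD.
rewrite ge0_integralD//; last 2 first.
- by move=> x; exact: E0.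
- by move=> x Dx; apply: E0 => //; rewrite subr_ge0.
under eq_integral do rewrite EFinM.
rewrite ge0_integralZl_EFin//; last by move=> x; exact: E0'.
under [X in (_ + X)%E]eq_integral do rewrite EFinM.
rewrite ge0_integralZl_EFin ?subr_ge0//; last by move=> x; exact: E0'.
have fins (z : R) : (\int[m]_(x in D) (expR (z * u x) * w x)%:E < c%:E)%E ->
   (\int[m]_(x in D) (expR (z * u x) * w x)%:E)%E \is a fin_num.
  move=> h; rewrite ge0_fin_numE; first by rewrite (lt_trans h)// ltry.
  by apply: integral_ge0 => x; exact: E0'.
have fA := fineK (fins _ Fs); have fB := fineK (fins _ Ft).
move: Fs Ft; rewrite -fA -fB -!EFinM -EFinD !lte_fin.
exact: key.
Qed.

End convex_measurability.

Section partition_function.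
Variable R : realType.
Variables (mu : measureR R) (p0 : R -> R).
Hypothesis dens : is_density mu p0.
Local Notation Z := (Zpart mu p0).
Local Notation Th := (Theta mu p0).
Local Notation kap := (kappa mu p0).

Lemma Zpart_measurable : measurable_fun [set: Borel R] (Z : Borel R -> \bar R).
Proof.
have [mp p0_ge0 _] := dens.
by apply: (@exp_integral_measurable _ mu setT p0 idfun) => //; exact: measurable_id.
Qed.

Lemma Theta_measurable : measurable (Th : set (Borel R)).
Proof.
by rewrite -[Th]setTI; apply: emeasurable_fun_infty_o => //; exact: Zpart_measurable.
Qed.

Lemma kappa_measurable : measurable_fun [set: Borel R] (kap : Borel R -> Borel R).
Proof.
apply: (@measurableT_comp _ _ _ _ _ _ (@ln R)) => //.
apply: (@measurableT_comp _ _ _ _ _ _ (@fine R)) => //.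
exact: Zpart_measurable.
Qed.

Lemma expRNkappa_measurable (D : set (Borel R)) :
  measurable_fun D ((fun t => expR (- kap t)) : Borel R -> R).
Proof.
apply: (@measurable_funS _ _ _ _ setT) => //.
apply: measurableT_comp => //; apply: measurableT_comp => //.
exact: kappa_measurable.
Qed.

Lemma lmix_measurable (g : distR R) :
  measurable_fun [set: Borel R] (lmix mu p0 g : Borel R -> \bar R).
Proof.
have -> : lmix mu p0 g = (fun x : Borel R => \int[g]_(t in Th)
    (expR (x * idfun t) * expR (- kap t))%:E)%E.
  by apply/funext => x; apply: eq_integral => t _; rewrite expRD [t * x]mulrC.
apply: exp_integral_measurable => //.
- exact: Theta_measurable.
- exact: expRNkappa_measurable.
- exact: measurable_id.
Qed.

Lemma Zpart_ge0 t : (0 <= Z t)%E.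
Proof.
have [_ p0_ge0 _] := dens.
by apply: integral_ge0 => x _; rewrite lee_fin mulr_ge0// expR_ge0.
Qed.

Lemma Zpart_fin_num t : Th t -> Z t \is a fin_num.
Proof. by move=> h; rewrite ge0_fin_numE// Zpart_ge0. Qed.

Lemma exp_density_measurable (h : R -> R) : measurable_fun [set: Borel R] (h : Borel R -> R) ->
  measurable_fun [set: Borel R] ((fun x => (h x * p0 x)%:E) : Borel R -> \bar R).
Proof.
by have [mp _ _] := dens; move=> mh; apply/measurable_EFinP; exact: measurable_funM.
Qed.

Lemma expRM_measurable (t : R) :
  measurable_fun [set: Borel R] ((fun x => expR (t * x)) : Borel R -> R).
Proof. by apply: measurableT_comp => //; exact: measurable_funM. Qed.

Lemma density_le_integral (h1 h2 : R -> R) :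
  measurable_fun [set: Borel R] (h1 : Borel R -> R) ->
  measurable_fun [set: Borel R] (h2 : Borel R -> R) ->
  (forall x, 0 <= h1 x <= h2 x) ->
  (\int[mu]_x (h1 x * p0 x)%:E <= \int[mu]_x (h2 x * p0 x)%:E)%E.
Proof.
have [_ p0_ge0 _] := dens.
move=> m1 m2 h12; apply: ge0_le_integral => //.
- by move=> x _; rewrite lee_fin mulr_ge0//; have /andP[] := h12 x.
- exact: exp_density_measurable.
- exact: exp_density_measurable.
- by move=> x _; rewrite lee_fin ler_wpM2r//; have /andP[] := h12 x.
Qed.

(** Inequalities on [Z] are obtained below by integrating pointwise inequalities between
    combinations of two exponentials. The identity also holds where [Z] is infinite. *)
Lemma integral_exp_combination (a b s t : R) : 0 <= a -> 0 <= b ->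
  (\int[mu]_x ((a * expR (s * x) + b * expR (t * x)) * p0 x)%:E
   = a%:E * Z s + b%:E * Z t)%E.
Proof.
have [_ p0_ge0 _] := dens.
move=> a0 b0.
have mE (z : R) := exp_density_measurable (expRM_measurable z).
have E0 (z x : R) : (0 <= (expR (z * x) * p0 x)%:E)%E.
  by rewrite lee_fin mulr_ge0// expR_ge0.
under eq_integral do rewrite mulrDl -!mulrA EFinD (EFinM a) (EFinM b).
rewrite ge0_integralD//; last 4 first.
- by move=> x _; rewrite mule_ge0.
- by apply: measurable_funeM; exact: mE.
- by move=> x _; rewrite mule_ge0.
- by apply: measurable_funeM; exact: mE.
by rewrite !ge0_integralZl_EFin.
Qed.

Lemma Zpart0 : Z 0 = 1%E.
Proof.
have [_ _ <-] := dens.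
by apply: eq_integral => x _; rewrite mul0r expR0 mul1r.
Qed.

Lemma kappa0 : kap 0 = 0.
Proof. by rewrite /kappa Zpart0/= ln1. Qed.

Lemma Zpart_le b t : `|t| <= b -> (Z t <= Z b + Z (- b))%E.
Proof.
move=> tb; have tb' := tb; move: tb'; rewrite ler_norml => /andP[t1 t2].
have := integral_exp_combination b (- b) ler01 ler01; rewrite !mul1e => <-.
apply: density_le_integral; first exact: expRM_measurable.
  apply: measurable_funD; apply: measurable_funM => //; exact: expRM_measurable.
move=> x; rewrite expR_ge0/= !mul1r.
have [x0|x0] := leP 0 x.
  by rewrite (@le_trans _ _ (expR (b * x)))// ?lerDl ?expR_ge0// ler_expR ler_wpM2r.
rewrite (@le_trans _ _ (expR (- b * x)))// ?lerDr ?expR_ge0// ler_expR.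
by rewrite ler_wnM2r// ltW.
Qed.

(* AM-GM: [s e^(t x) + e^(-t x) / s >= 2] for every [s > 0] *)
Lemma Zpart_opp_ge (s t : R) : 0 < s -> (2%:E <= s%:E * Z t + s^-1%:E * Z (- t))%E.
Proof.
move=> s0; rewrite -integral_exp_combination ?invr_ge0 ?(ltW s0)//.
have -> : 2%:E = (\int[mu]_x ((2 * expR (0 * x) + 0 * expR (0 * x)) * p0 x)%:E)%E.
  by rewrite integral_exp_combination// Zpart0 mule1 mul0e adde0.
apply: density_le_integral.
- apply: measurable_funD; apply: measurable_funM => //; exact: expRM_measurable.
- apply: measurable_funD; apply: measurable_funM => //; exact: expRM_measurable.
move=> x; rewrite mul0r expR0 mul0r addr0 mulr1 ler0n/=.
rewrite mulNr expRN; have e0 := expR_gt0 (t * x).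
set e := expR _ in e0 *; have -> : s^-1 * e^-1 = (s * e)^-1 by rewrite invfM.
have : 0 < s * e by rewrite mulr_gt0.
move: (s * e) => y y0; have yy : y * y^-1 = 1 by rewrite divff// gt_eqF.
have yi : 0 < y^-1 by rewrite invr_gt0.
have := sqr_ge0 (y - 1); nra.
Qed.

(** Taking [s = Z (- t)] in [Zpart_opp_ge] gives the product bound; [Z (- t) = 0] is excluded by
    [s = 1 / (Z t + 1)]. Positivity matters because [kappa] is a logarithm with the convention
    [ln 0 = 0]. *)
Lemma Zpart_mul_ge1 t : Th t -> Th (- t) ->
  0 < fine (Z t) /\ 1 <= fine (Z t) * fine (Z (- t)).
Proof.
have key (u v : R) : 0 <= u -> 0 <= v ->
    (forall s, 0 < s -> 2 <= s * u + s^-1 * v) -> 0 < u /\ 1 <= u * v.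
  move=> u0 v0 H; have [v_gt0|v_le0] := ltP 0 v.
    by have := H v v_gt0; rewrite mulVf ?gt_eqF// => h; split; nra.
  have v_eq0 : v = 0 by lra.
  have u1 : 0 < u + 1 by lra.
  have := H (u + 1)^-1; rewrite invr_gt0 => /(_ u1); rewrite v_eq0 mulr0 addr0 => h.
  have : (u + 1)^-1 * u <= 1 by rewrite ler_pdivrMl; lra.
  by lra.
move=> /Zpart_fin_num /fineK h1 /Zpart_fin_num /fineK h2.
apply: key => [||s s0]; [by rewrite fine_ge0// Zpart_ge0|by rewrite fine_ge0// Zpart_ge0|].
by have := Zpart_opp_ge t s0; rewrite -h1 -h2 -!EFinM -EFinD lee_fin.
Qed.

(** The lower bound at [t] follows from the upper bound at [- t], as the product of the two values
    of [Z] is at least 1. *)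
Lemma kappa_bounded b : 0 <= b -> `[- b, b]%classic `<=` Th ->
  exists B, forall t, `|t| <= b -> `|kap t| <= B.
Proof.
move=> b0 bT.
have T (t : R) : `|t| <= b -> Th t.
  by move=> tb; apply: bT; rewrite /= in_itv/= -ler_norml.
pose S := fine (Z b) + fine (Z (- b)).
have T1 : Th b by apply: T; rewrite ger0_norm.
have T2 : Th (- b) by apply: T; rewrite normrN ger0_norm.
exists (ln S) => t tb.
have Tt := T _ tb; have Tt' : Th (- t) by apply: T; rewrite normrN.
have ZS (u : R) : `|u| <= b -> Th u -> fine (Z u) <= S.
  move=> /Zpart_le + /Zpart_fin_num/fineK Zu.
  by rewrite -Zu -(fineK (Zpart_fin_num T1)) -(fineK (Zpart_fin_num T2)) -EFinD lee_fin.
have [z1 h] := Zpart_mul_ge1 Tt Tt'.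
have h1 := ZS _ tb Tt.
have h2 : fine (Z (- t)) <= S by apply: ZS => //; rewrite normrN.
have S0 : 0 < S := lt_le_trans z1 h1.
have SV0 : 0 < S^-1 by rewrite invr_gt0.
rewrite ler_norml /kappa; apply/andP; split; last by rewrite (ler_ln z1 S0).
rewrite -(lnV S0) (ler_ln SV0 z1) -div1r (ler_pdivrMr _ _ S0).
by apply: le_trans h _; rewrite (ler_pM2l z1).
Qed.

(** Convexity of [kappa] on rays from 0, where it vanishes. In place of the Hoelder inequality,
    convexity of [exp] between [t x - ln c] and 0, with [c = Z t], is integrated: after this
    normalization the right side has integral 1. *)
Lemma kappa_star (l t : R) : (forall t, Th t) -> 0 <= l <= 1 ->
  kap (l * t) <= l * kap t.
Proof.
move=> T /[dup] l01 /andP[l0 l1].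
have pos (u : R) : 0 < fine (Z u) by have [] := Zpart_mul_ge1 (T u) (T (- u)).
set c := fine (Z t); have c0 : 0 < c := pos t.
have cl : expR (l * kap t) = expR (l * ln c) by [].
suff h : fine (Z (l * t)) <= expR (l * kap t).
  by rewrite -ler_expR {1}/kappa lnK ?posrE ?pos.
have fK (u : R) := fineK (Zpart_fin_num (T u)).
rewrite -lee_fin fK cl.
have -> : (expR (l * ln c))%:E = ((expR (l * ln c) * (l / c))%:E * Z t
    + (expR (l * ln c) * (1 - l))%:E * Z 0)%E.
  rewrite Zpart0 mule1 -fK -/c -EFinM -EFinD; congr EFin.
  by field; rewrite gt_eqF.
rewrite -integral_exp_combination; last 2 first.
- by rewrite mulr_ge0 ?expR_ge0// divr_ge0// ltW.
- by rewrite mulr_ge0 ?expR_ge0// subr_ge0.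
apply: density_le_integral.
- exact: expRM_measurable.
- apply: measurable_funD; apply: measurable_funM => //; exact: expRM_measurable.
move=> x; rewrite expR_ge0/= mul0r expR0 mulr1.
have := expR_convex (t * x - ln c) 0 l01.
rewrite mulr0 addr0 expR0 mulr1 expRB lnK ?posrE// => h.
have -> : l * t * x = l * ln c + l * (t * x - ln c) by ring.
rewrite expRD; have := ler_wpM2l (expR_ge0 (l * ln c)) h.
by move=> /le_trans; apply; rewrite le_eqVlt; apply/orP; left; apply/eqP; ring.
Qed.

End partition_function.

Section support.
Variable R : realType.
Implicit Types g : distR R.

(** Every point outside the support has a null neighbourhood, hence a null interval with rational
    endpoints around it, and these are countably many. [F] enumerates them, other codes being sent
    to the empty set. *)
Lemma supp_subset_null g (b : R) : supp g `<=` `[- b, b]%classic ->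
  g (~` `[- b, b]%classic) = 0%E.
Proof.
move=> gb.
pose I (q : rat * rat) : set (Borel R) := `]ratr q.1, ratr q.2[%classic.
pose F (k : nat) : set (Borel R) :=
  if (unpickle k : option (rat * rat)) is Some q then
    if (g (I q) == 0)%E then I q else set0 else set0.
apply: measure_negligible; first by apply: measurableC; exact: measurable_itv.
apply: (@negligibleS _ _ _ _ (\bigcup_k F k)); last first.
  apply: negligible_bigcup => k; rewrite /F.
  case: unpickle => [q|]; last exact: negligible_set0.
  case: ifPn => [/eqP gI|_]; last exact: negligible_set0.
  by apply/negligibleP => //; exact: measurable_itv.
move=> t tb.
have : ~ supp g t by move=> /gb.
rewrite /supp /= => /existsNP[U /not_implyP[oU /not_implyP[Ut gU]]].
have gU0 : g U = 0%E.
  by apply/eqP; rewrite eq_le measure_ge0 andbT leNgt; apply/negP.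
have [e /= e0 eU] : exists2 e : R, 0 < e & forall y, `|t - y| < e -> U y.
  have /nbhs_ballP[e e0 eU] : nbhs t U by apply: open_nbhs_nbhs.
  by exists e => // y ty; apply: eU.
have /rat_in_itvoo[q1] : t - e < t by rewrite ltrBlDr ltrDl.
rewrite in_itv/= => /andP[q1a q1b].
have /rat_in_itvoo[q2] : t < t + e by rewrite ltrDl.
rewrite in_itv/= => /andP[q2a q2b].
exists (pickle (q1, q2)); first exact: Logic.I.
rewrite /F pickleK.
have IU : I (q1, q2) `<=` U.
  move=> y; rewrite /I /= in_itv/= => /andP[y1 y2]; apply: eU.
  rewrite ltr_norml; apply/andP; split; lra.
have -> : (g (I (q1, q2)) == 0)%E.
  rewrite eq_le measure_ge0 andbT -gU0 le_measure// inE.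
    exact: measurable_itv.
  exact: open_measurable.
by rewrite /I /= in_itv/= q1b.
Qed.

End support.

Section concentrated_mixing.
Variable R : realType.
Variables (mu : measureR R) (p0 : R -> R).
Hypothesis dens : is_density mu p0.
Variables (b : R) (g : distR R).
Hypothesis b0 : 0 <= b.
Hypothesis bT : `[- b, b]%classic `<=` Theta mu p0.
Hypothesis gb : g (~` `[- b, b]%classic) = 0%E.
Local Notation kap := (kappa mu p0).
Local Notation K := (`[- b, b]%classic : set (Borel R)).

Definition tilted_integral (f : R -> R) : R :=
  \int[g]_(t in K) (f t * expR (- kap t)).

Lemma concentrated_measure : g K = 1%E.
Proof.
have := @probability_setC _ _ _ g K (measurable_itv _); rewrite gb => h.
have gf : g K \is a fin_num by exact: fin_num_measure.
move: h; rewrite -(fineK gf) -EFinB => -[] /eqP.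
by rewrite eq_sym subr_eq0 => /eqP <-.
Qed.

Let bN : - b <= b. Proof. by rewrite lerNl (le_trans _ b0)// oppr_le0. Qed.

Lemma bounded_tilted_integrable (f : R -> R) (C : R) :
  measurable_fun K (f : Borel R -> R) -> (forall t, `|t| <= b -> `|f t| <= C) ->
  g.-integrable K (EFin \o (fun t => f t * expR (- kap t))).
Proof.
move=> mf fC.
have [B kB] := kappa_bounded dens b0 bT.
apply: (@le_integrable _ _ _ _ _ _ _ (cst (C * expR B)%:E)).
- exact: measurable_itv.
- apply/measurable_EFinP; apply: measurable_funM => //.
  exact: expRNkappa_measurable.
- move=> t; rewrite /= in_itv/= -ler_norml => tb.
  rewrite lee_fin normrM [leRHS]ger0_norm.
    apply: ler_pM => //; first exact: fC.
    rewrite ger0_norm ?expR_ge0// ler_expR.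
    by have := kB t tb; rewrite ler_norml lerNl => /andP[].
  rewrite mulr_ge0 ?expR_ge0//; apply: le_trans (fC t tb); exact: normr_ge0.
- by apply: finite_measure_integrable_cst.
Qed.

Lemma continuous_tilted_integrable (f : R -> R) : continuous f ->
  g.-integrable K (EFin \o (fun t => f t * expR (- kap t))).
Proof.
move=> cf; have cn : {within `[- b, b], continuous (fun t => `|f t|)}.
  apply: continuous_subspaceT => t; apply: continuous_comp; first exact: cf.
  exact: norm_continuous.
have [c _ hc] := EVT_max bN cn.
apply: (@bounded_tilted_integrable f `|f c|).
  by apply: measurable_funS (continuous_measurable_fun cf).
by move=> t tb; apply: hc; rewrite in_itv/= -ler_norml.
Qed.

(** Strict positivity rests on compactness: [f] has a positive minimum on [[-b, b]], where [kappa]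
    is bounded and [g] has mass 1. *)
Lemma tilted_integral_pos_functional : pos_functional b tilted_integral.
Proof.
split.
- move=> c f h cf ch; rewrite /tilted_integral.
  rewrite -RintegralZl ?continuous_tilted_integrable//.
  rewrite -RintegralD ?continuous_tilted_integrable//.
  + by apply: eq_Rintegral => t _; rewrite mulrDl mulrA.
  + rewrite (_ : (fun t => c * _) = (fun t => c * f t * expR (- kap t))).
      apply: continuous_tilted_integrable => t.
      by apply: cvgM; [exact: cvg_cst|exact: cf].
    by apply/funext => t; rewrite mulrA.
- move=> f h cf ch fh; apply: le_Rintegral; rewrite ?continuous_tilted_integrable//.
  by move=> t; rewrite /= in_itv/= -ler_norml => /fh; rewrite ler_pM2r// expR_gt0.
- move=> f cf f0.
  have [c /[!in_itv]/= cb hc] := EVT_min bN (continuous_subspaceT cf).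
  have [B kB] := kappa_bounded dens b0 bT.
  have fc0 : 0 < f c by apply: f0; rewrite ler_norml.
  apply: (@lt_le_trans _ _ (\int[g]_(t in K) (f c * expR (- B)))).
    rewrite Rintegral_cst// [fine _](congr1 fine concentrated_measure).
    by rewrite/= mulr1 mulr_gt0 ?expR_gt0.
  apply: le_Rintegral => //.
  + by apply: finite_measure_integrable_cst.
  + exact: continuous_tilted_integrable.
  + move=> t /= tb; apply: ler_pM; rewrite ?expR_ge0 ?(ltW fc0)//; first exact: hc.
    rewrite ler_expR lerN2; move: tb; rewrite in_itv/= -ler_norml => /kB.
    by rewrite ler_norml => /andP[].
Qed.

Lemma lmix_concentrated (x : R) :
  lmix mu p0 g x = (tilted_integral (fun t => expR (t * x)))%:E.
Proof.
have ce : continuous (fun t : R => expR (t * x)).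
  move=> s; apply: (cvg_comp (fun s : R => s * x) expR).
    by apply: cvgM; [exact: cvg_id|exact: cvg_cst].
  exact: continuous_expR.
have me : measurable_fun (Theta mu p0 : set (Borel R))
    ((fun t => (expR (t * x - kap t))%:E) : Borel R -> \bar R).
  apply/measurable_EFinP; apply: measurableT_comp => //.
  apply: measurable_funB; first exact: measurable_funM.
  by apply: measurable_funS (kappa_measurable dens).
rewrite /tilted_integral /Rintegral fineK; last first.
  by apply: integrable_fin_num => //; exact: continuous_tilted_integrable.
rewrite /lmix (@ge0_negligible_integral _ _ _ _ _ (~` K)) => //.
- rewrite setDE setCK (_ : _ `&` K = K); last exact/setIidPr.
  by apply: eq_integral => t _; rewrite expRD.
- by apply: measurableC; exact: measurable_itv.
- exact: Theta_measurable.
Qed.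

End concentrated_mixing.

(** * Comparison of the likelihoods *)

Section discrete_measures.
Variable R : realType.
Implicit Types (m : measureR R) (Q : distR R) (s : seq R) (x : nat -> R).

(* [s] may contain repetitions, each occurrence of [t] counting for [c t]. *)
Definition discrete m s (c : R -> R) : Prop :=
  (forall t, 0 <= c t) /\
  forall f : R -> \bar R, measurable_fun [set: Borel R] (f : Borel R -> \bar R) ->
    (forall t, 0 <= f t)%E ->
    (\int[m]_t f t = \sum_(t <- s) (c t)%:E * f t)%E.

(** Meant for integrands of either sign, such as [lne (lmix ..)], that may be infinite elsewhere.
    Finiteness is asked only at points of positive weight, because only those nodes of a rule are
    known to lie in the range of the data. *)
Lemma discrete_integral m s c (f : R -> \bar R) : discrete m s c ->
  measurable_fun [set: Borel R] (f : Borel R -> \bar R) ->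
  (forall t, t \in s -> 0 < c t -> f t \is a fin_num) ->
  (\int[m]_t f t = (\sum_(t <- s) c t * fine (f t))%:E)%E.
Proof.
move=> [c0 h] mf ffin.
have ce (k : R -> \bar R) : (forall t, f t \is a fin_num -> k t \is a fin_num) ->
    (\sum_(t <- s) (c t)%:E * k t)%E = (\sum_(t <- s) c t * fine (k t))%:E.
  move=> kf; rewrite -sumEFin; apply: eq_big_seq => t ts.
  have [ct|ct] := ltP 0 (c t).
    by rewrite EFinM fineK//; apply: kf; exact: ffin.
  have -> : c t = 0 by apply/eqP; rewrite eq_le ct c0.
  by rewrite mul0e mul0r.
rewrite integralE !h//; last 2 first.
- exact: measurable_funeneg.
- exact: measurable_funepos.
rewrite ce; last by move=> t; rewrite funeposE; case: (f t) => //= r _; rewrite -EFin_max.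
rewrite ce; last by move=> t; rewrite funenegE; case: (f t) => //= r _; rewrite -EFin_max.
rewrite -EFinB -sumrB; congr EFin; apply: eq_big_seq => t ts.
have [ct|ct] := ltP 0 (c t); last first.
  have -> : c t = 0 by apply/eqP; rewrite eq_le ct c0.
  by rewrite !mul0r subrr.
rewrite -mulrBr; congr (_ * _).
have := ffin _ ts ct; rewrite funeposE funenegE; case: (f t) => //= r _.
have [r0|r0] := leP 0 r.
  by rewrite -!EFin_max/= max_l// max_r ?subr0// oppr_le0.
by rewrite -!EFin_max/= max_r ?(ltW r0)// max_l ?oppr_ge0 ?(ltW r0)// sub0r opprK.
Qed.

Lemma discrete_empirical n x : (0 < n)%N ->
  discrete (empirical n x) [seq x i | i <- iota 0 n] (fun=> n%:R^-1).
Proof.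
move=> n0; split => [_|f mf f0]; first by rewrite invr_ge0.
rewrite /empirical ge0_integral_mscale//=.
rewrite ge0_integral_measure_sum//.
rewrite big_map -[n in iota 0 n]subn0 big_mkord -ge0_sume_distrr//.
congr (_ * _)%E; apply: eq_bigr => i _.
by rewrite integral_dirac// diracT mul1e.
Qed.

Lemma discrete_finite_support Q s : Q [set t | t \in s] = 1%E -> uniq s ->
  discrete Q s (fun t => fine (Q [set t])).
Proof.
move=> Qs us; split => [t|f mf f0]; first by rewrite fine_ge0.
have ms (l : seq R) : measurable ([set t | t \in l] : set (Borel R)).
  elim: l => [|t l IH]; first by rewrite (_ : [set _ | _] = set0)//; apply/seteqP; split.
  rewrite (_ : [set _ | _] = [set t] `|` [set t | t \in l]).
    by apply: measurableU => //; exact: measurable_set1.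
  apply/seteqP; split => u /=; rewrite in_cons.
    by move=> /orP[/eqP ->|ul]; [left|right].
  by move=> [->|ul]; rewrite ?eqxx ?ul ?orbT.
have mN : measurable (~` [set t | t \in s] : set (Borel R)) by exact: measurableC.
have QN : Q (~` [set t | t \in s]) = 0%E by rewrite probability_setC// Qs subee.
rewrite (ge0_negligible_integral mN measurableT mf _ QN)//.
rewrite setTD setCK.
have mf' (D : set (Borel R)) : measurable_fun D (f : Borel R -> \bar R).
  exact: measurable_funS mf.
elim: s us {Qs mN QN} => [|t l IH] /=.
  move=> _; rewrite big_nil (_ : [set _ | _] = set0) ?integral_set0//.
  by apply/seteqP; split.
move=> /andP[tl ul]; rewrite big_cons -IH//.
rewrite (_ : [set u | u \in t :: l] = [set t] `|` [set u | u \in l]); last first.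
  apply/seteqP; split => u /=; rewrite in_cons.
    by move=> /orP[/eqP ->|]; [left|right].
  by move=> [->|ul']; rewrite ?eqxx ?ul' ?orbT.
rewrite ge0_integral_setU//; last first.
- rewrite disj_set2E; apply/eqP/seteqP; split => // u [/= -> tl'].
  by rewrite tl' in tl.
congr (_ + _)%E.
rewrite (eq_integral (cst (f t))); last by move=> u; rewrite inE/= => ->.
by rewrite integral_cst// muleC fineK// fin_num_measure.
Qed.

Lemma maxabs_ge n x i : (i < n)%N -> `|x i| <= maxabs n x.
Proof.
move=> i_n; rewrite /maxabs.
by apply: (le_bigmax _ (fun i : 'I_n => `|x i|) (Ordinal i_n)).
Qed.

Lemma maxabs_ge0 n x : 0 <= maxabs n x.
Proof. exact: bigmax_ge_id. Qed.

(** [undup] makes the nodes distinct, as the node bound requires. *)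
Lemma gauss_quadrature_discrete n x J Q : (0 < n)%N -> (0 < J)%N ->
  gauss_quadrature n x J Q ->
  exists s (q : R -> R), [/\ discrete Q s q, uniq s /\ (size s <= J)%N,
    forall k, (k <= (2 * J).-1)%N ->
      \sum_(t <- s) q t * t ^+ k = n%:R^-1 * \sum_(i < n) x i ^+ k
  & forall t, t \in s -> 0 < q t -> `|t| <= maxabs n x].
Proof.
move=> n0 J0 [[s0 s0J Qs0] mom _].
pose s := undup s0.
have Qs : Q [set t | t \in s] = 1%E.
  by rewrite -Qs0; congr (Q _); apply/seteqP; split => t /=; rewrite mem_undup.
have us : uniq s by exact: undup_uniq.
have sJ : (size s <= J)%N by rewrite (leq_trans (size_undup _)).
have dQ := discrete_finite_support Qs us.
have dP := @discrete_empirical n x n0.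
exists s, (fun t => fine (Q [set t])).
have mX k : measurable_fun [set: Borel R] ((fun t => (t ^+ k)%:E) : Borel R -> \bar R).
  by apply/measurable_EFinP; exact: measurable_funX.
have mom' k : (k <= (2 * J).-1)%N ->
    \sum_(t <- s) fine (Q [set t]) * t ^+ k = n%:R^-1 * \sum_(i < n) x i ^+ k.
  move=> /mom; rewrite (discrete_integral dQ)// (discrete_integral dP)// => -[->].
  by rewrite big_map -[n in iota 0 n]subn0 big_mkord mulr_sumr.
split => // t ts qt; apply: (quadrature_node_bound J0 mom') => // i i_n.
exact: maxabs_ge.
Qed.

End discrete_measures.

Section likelihood_comparison.
Variable R : realType.
Variables (mu : measureR R) (p0 : R -> R).
Hypothesis dens : is_density mu p0.
Local Notation kap := (kappa mu p0).
Implicit Types (g : distR R) (x : nat -> R).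

Lemma lne_lmix_measurable g :
  measurable_fun [set: Borel R] ((fun t => lne (lmix mu p0 g t)) : Borel R -> \bar R).
Proof.
have ml := lmix_measurable dens g.
apply: (measurability _ (ErealGenOInfty.measurableE R)) => //.
move=> _ [_ [c ->] <-]; apply: measurableI => //.
rewrite (_ : _ @^-1` _ = setT `&` [set t | ((expR c)%:E < lmix mu p0 g t)%E]).
  by apply: emeasurable_fun_o_infty => //.
rewrite setTI; apply/seteqP; split => t /=; rewrite in_itv/= andbT.
  case: (lmix mu p0 g t) => [r| |]/=; [|by rewrite !ltry|by rewrite !ltNge !leNye].
  case: ifPn => // r0; rewrite !lte_fin => h; rewrite -ltNge in r0.
  by rewrite -[r]lnK// ltr_expR.
case: (lmix mu p0 g t) => [r| |]/=; [|by rewrite !ltry|by rewrite !ltNge !leNye].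
rewrite lte_fin => h; have r0 : 0 < r by rewrite (lt_trans _ h)// expR_gt0.
by rewrite leNgt r0/= lte_fin -ltr_expR lnK.
Qed.

Lemma fmixE g (y : R) : fmix mu p0 g y = (lmix mu p0 g y * (p0 y)%:E)%E.
Proof.
have [_ p0_ge0 _] := dens.
rewrite /fmix /lmix muleC -ge0_integralZl_EFin//.
- by apply: eq_integral => t _; rewrite /ptheta EFinM muleC.
- exact: Theta_measurable.
- apply/measurable_EFinP; apply: measurableT_comp => //.
  apply: measurable_funB; first exact: measurable_funM.
  by apply: measurable_funS (kappa_measurable dens).
Qed.

Lemma loglik_real n x g (l : R -> R) :
  (forall i, (i < n)%N -> lmix mu p0 g (x i) = (l (x i))%:E /\ 0 < l (x i)) ->
  (forall i, (i < n)%N -> 0 < p0 (x i)) ->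
  loglik n x (fmix mu p0 g) =
    (\sum_(i < n) ln (l (x i)) + \sum_(i < n) ln (p0 (x i)))%:E.
Proof.
move=> hl hp; rewrite /loglik -big_split/= -sumEFin; apply: eq_bigr => i _.
have [lE l0] := hl i (ltn_ord i); have pi := hp i (ltn_ord i).
by rewrite fmixE lE -EFinM lne_EFin ?mulr_gt0// lnM.
Qed.

Lemma kappa_sup_ge0 b : 0 <= b -> `[- b, b]%classic `<=` Theta mu p0 ->
  0 <= sup [set `|kap t| | t in `[- b, b]%classic].
Proof.
move=> b0 bT; have [B kB] := kappa_bounded dens b0 bT.
rewrite -(normr0 R) -(kappa0 dens); apply: ub_le_sup.
  by exists B => _ [t + <-]; rewrite /= in_itv/= -ler_norml => /kB.
by exists 0 => //=; rewrite in_itv/= oppr_le0 b0.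
Qed.

(** [g1] plays the NPMLE and [g2] the quadrature estimator; their optimality enters only through the
    comparison under [Q]. The error per observation is at most [1 / X], and
    [n / X = n ^ (- gamma)]. *)
Lemma loglik_comparison n x J (b gamma : R) (Q g1 g2 : distR R) :
  (0 < n)%N -> (0 < J)%N -> 0 < gamma -> 0 <= b ->
  `[- b, b]%classic `<=` Theta mu p0 ->
  g1 (~` `[- b, b]%classic) = 0%E -> g2 (~` `[- b, b]%classic) = 0%E ->
  (forall i, (i < n)%N -> 0 < p0 (x i)) ->
  1 <= maxabs n x * b ->
  quad_order mu p0 100 gamma n x b = J%:Z ->
  gauss_quadrature n x J Q ->
  (\int[Q]_t lne (lmix mu p0 g1 t) <= \int[Q]_t lne (lmix mu p0 g2 t))%E ->
  (loglik n x (fmix mu p0 g1) - loglik n x (fmix mu p0 g2)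
    <= (n%:R `^ (- gamma))%:E)%E.
Proof.
move=> n0 J0 gam0 b0 bT g1b g2b px; set A := maxabs n x => a1.
have A_ge0 : 0 <= A by exact: maxabs_ge0.
have A0 : 0 < A by rewrite lt_neqAle A_ge0 andbT; apply: contraTneq a1 => <-; rewrite mul0r -ltNge.
have b_gt0 : 0 < b by rewrite lt_neqAle b0 andbT; apply: contraTneq a1 => <-; rewrite mulr0 -ltNge.
rewrite /quad_order -/A; set K := sup _ => JE gQ QE.
have K0 : 0 <= K by exact: kappa_sup_ge0.
set X := n%:R `^ (1 + gamma).
have n1 : 1 <= n%:R :> R by rewrite ler1n.
have X1 : 1 <= X by rewrite -(powRr0 n%:R) ler_powR//; lra.
have Jb : 2 * (A * b) * ln (100 * X * (A * b) * (A * b + K)) <= J%:R.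
  by rewrite -[J%:R]/(J%:Z%:~R) -JE; exact: ceil_ge.
have [m m64 merr] := approximation_error_bound a1 X1 K0 Jb.
have [s [q [dQ [us sJ] mom qA]]] := gauss_quadrature_discrete n0 J0 gQ.
(* Degree [2 J - 1] means size [2 J], the exactness range of the rule; the truncated predecessor is
   harmless because [J > 0]. *)
have J2 : (2 * J).-1.+1 = (2 * J)%N by rewrite prednK// muln_gt0.
pose l g t := tilted_integral mu p0 b g (fun s => expR (s * t)).
have lE g : g (~` `[- b, b]%classic) = 0%E -> forall t, lmix mu p0 g t = (l g t)%:E.
  by move=> gb t; exact: lmix_concentrated.
have If g : g (~` `[- b, b]%classic) = 0%E -> pos_functional b (tilted_integral mu p0 b g).
  by move=> gb; exact: tilted_integral_pos_functional.
have l0 g : g (~` `[- b, b]%classic) = 0%E -> forall t, 0 < l g t.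
  move=> gb t; have [_ _] := If g gb; apply => [|u _]; last exact: expR_gt0.
  move=> u; apply: (cvg_comp (fun u : R => u * t) expR).
    by apply: cvgM; [exact: cvg_id|exact: cvg_cst].
  exact: continuous_expR.
rewrite (loglik_real (l := l g1))//; last by move=> i _; split; [exact: lE|exact: l0].
rewrite (loglik_real (l := l g2))//; last by move=> i _; split; [exact: lE|exact: l0].
rewrite -EFinB lee_fin opprD addrACA subrr addr0.
have Qint g : g (~` `[- b, b]%classic) = 0%E ->
    (\int[Q]_t lne (lmix mu p0 g t))%E = (\sum_(t <- s) q t * ln (l g t))%:E.
  move=> gb; rewrite (discrete_integral dQ (lne_lmix_measurable g)).
    by congr EFin; apply: eq_bigr => t _; rewrite lE// lne_EFin// l0.
  by move=> t _ _; rewrite lE// lne_EFin// l0.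
move: QE; rewrite !Qint// lee_fin => hQ.
have [p1 sp1 hp1] := ln_laplace_approx (2 * J).-1 (If _ g1b) A0 b_gt0 a1 m64.
have [p2 sp2 hp2] := ln_laplace_approx (2 * J).-1 (If _ g2b) A0 b_gt0 a1 m64.
move: sp1 sp2 hp1 hp2; rewrite !J2 => sp1 sp2 hp1 hp2.
have xA i : (i < n)%N -> `|x i| <= A by exact: maxabs_ge.
have q0 : forall t, 0 <= q t by have [] := dQ.
have := quadrature_comparison n0 J0 mom us sJ xA q0 sp1 sp2 hp1 hp2 hQ.
move=> /le_trans; apply.
have np : 0 < n%:R :> R by rewrite ltr0n.
have -> : n%:R `^ (- gamma) = X^-1 * n%:R.
  rewrite /X -powRN -[X in _ * X]powRr1 ?ler0n// -powRD; first by congr powR; ring.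
  by rewrite (gt_eqF np) implybT.
by rewrite ler_pM2r.
Qed.

End likelihood_comparison.

(** * Localization of the estimators *)

Section clipping.
Variable R : realType.
Implicit Types g : distR R.

Lemma integral_gt0 g (D : set (Borel R)) (f : R -> \bar R) : measurable D ->
  measurable_fun D (f : Borel R -> \bar R) -> (forall t, D t -> 0 < f t)%E ->
  (0 < g D)%E -> (0 < \int[g]_(t in D) f t)%E.
Proof.
move=> mD mf f0 gD.
rewrite lt_neqAle integral_ge0 ?andbT; last by move=> t /f0/ltW.
apply/eqP => /esym i0.
have : (\int[g]_(t in D) `|f t| = 0)%E.
  rewrite -[RHS]i0; apply: eq_integral => t; rewrite inE => /f0/ltW h.
  by rewrite gee0_abs.
move=> /(ae_eq_integral_abs _ mD mf)[N [mN N0 DN]].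
have : (g D <= g N)%E.
  apply: le_measure; rewrite ?inE// => t Dt; apply: DN => /= /(_ Dt) ft.
  by have := f0 _ Dt; rewrite ft ltxx.
by rewrite N0 leNgt gD.
Qed.

Lemma concentrated_supp g b : g (~` `[- b, b]%classic) = 0%E -> supp g `<=` `[- b, b]%classic.
Proof.
move=> gK t; rewrite /supp /= => ht; apply: contrapT => tK.
have oU : open (~` `[- b, b]%classic : set R).
  by apply: closed_openC; exact: interval_closed.
by have := ht _ oU tK; rewrite gK ltxx.
Qed.

Definition clip (b t : R) : R := Num.max (- b) (Num.min b t).

Lemma clip_le b t : 0 <= b -> `|clip b t| <= b.
Proof.
by move=> b0; rewrite ler_norml /clip le_max lexx/= ge_max ge_min lexx/= andbT; lra.
Qed.

Lemma clip_id b t : `|t| <= b -> clip b t = t.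
Proof.
by rewrite ler_norml => /andP[t1 t2]; rewrite /clip min_r// max_r.
Qed.

Lemma clip_measurable b : measurable_fun [set: Borel R] (clip b : Borel R -> Borel R).
Proof.
apply: (@measurable_maxr _ _ _ _ (cst (- b))) => //.
by apply: (@measurable_minr _ _ _ _ (cst b)).
Qed.

Lemma clip_distribution b g : 0 <= b ->
  exists h : distR R, h (~` `[- b, b]%classic) = 0%E /\
    forall F : R -> \bar R, measurable_fun [set: Borel R] (F : Borel R -> \bar R) ->
      (forall t, 0 <= F t)%E -> (\int[h]_t F t = \int[g]_t F (clip b t))%E.
Proof.
move=> b0.
pose mx := isMeasurableFun.Build _ _ _ _ _ (@clip_measurable b).
pose X : {mfun Borel R >-> Borel R} := HB.pack (clip b : Borel R -> Borel R) mx.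
pose h : distR R := distribution g X.
exists h; split.
  have -> : h (~` `[- b, b]%classic) = g (clip b @^-1` (~` `[- b, b]%classic)) by [].
  rewrite (_ : _ @^-1` _ = set0) ?measure0//.
  apply/seteqP; split => // t /=; apply.
  by rewrite in_itv/= -ler_norml clip_le.
move=> F mF F0.
by rewrite /h /distribution ge0_integral_pushforward.
Qed.

End clipping.

Section clipped_likelihood.
Variable R : realType.
Variables (mu : measureR R) (p0 : R -> R).
Hypothesis dens : is_density mu p0.
Hypothesis allT : forall t, Theta mu p0 t.
Variables (A b : R).
Hypothesis b0 : 0 <= b.
Local Notation kap := (kappa mu p0).
Local Notation K := (`[- b, b]%classic : set (Borel R)).
(** Clipping raises the exponent at every point of the data range; [clip_dominates] provides this
    for [b = c A ^ a1]. *)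
Hypothesis dom : forall t x, b < `|t| -> `|x| <= A ->
  t * x - kap t < clip b t * x - kap (clip b t).
Implicit Types (g : distR R) (x : nat -> R).

Let ThetaT : Theta mu p0 = setT.
Proof. by apply/seteqP; split => t _ //; exact: allT. Qed.

Let bT : `[- b, b]%classic `<=` Theta mu p0.
Proof. by move=> t _; exact: allT. Qed.

Let tilt_measurable (y : R) : measurable_fun [set: Borel R]
    ((fun t => (expR (t * y - kap t))%:E) : Borel R -> \bar R).
Proof.
apply/measurable_EFinP; apply: measurableT_comp => //.
apply: measurable_funB; first exact: measurable_funM.
exact: kappa_measurable.
Qed.

Let mK : measurable K. Proof. exact: measurable_itv. Qed.

Lemma lmix_gt0 g (y : R) : (0 < lmix mu p0 g y)%E.
Proof.
rewrite /lmix ThetaT; apply: integral_gt0 => //.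
  by move=> t _; rewrite lte_fin expR_gt0.
by rewrite probability_setT.
Qed.

(** The gain is the integral of a positive function over the complement of [[-b, b]], which [g]
    charges. Finiteness belongs to the claim: in the extended reals, adding a positive quantity
    gives a strict increase only from a finite value. *)
Lemma lmix_clip_gt g : g (~` K) != 0%E ->
  exists h : distR R, h (~` K) = 0%E /\
    forall y, `|y| <= A -> (lmix mu p0 g y < lmix mu p0 h y < +oo)%E.
Proof.
move=> gK; have gK0 : (0 < g (~` K))%E by rewrite lt0e gK/=.
have [h [hK hE]] := clip_distribution g b0.
exists h; split => // y yA.
have hfin : (lmix mu p0 h y < +oo)%E by rewrite (lmix_concentrated dens b0 bT hK) ltry.
rewrite hfin andbT.
pose G t := (expR (t * y - kap t))%:E.
pose H t := (expR (clip b t * y - kap (clip b t)))%:E.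
have mG : measurable_fun [set: Borel R] (G : Borel R -> \bar R) by exact: tilt_measurable.
have mH : measurable_fun [set: Borel R] (H : Borel R -> \bar R).
  exact: (measurableT_comp (tilt_measurable y) (@clip_measurable R b)).
have G0 t : (0 <= G t)%E by rewrite lee_fin expR_ge0.
have hE' : lmix mu p0 h y = (\int[g]_t H t)%E.
  by rewrite /lmix ThetaT; exact: (hE G mG G0).
have gE' : lmix mu p0 g y = (\int[g]_t G t)%E.
  by rewrite /lmix ThetaT; apply: eq_integral.
have KU : [set: Borel R] = K `|` ~` K by rewrite setUv.
have KD : [disjoint K & ~` K] by rewrite disj_set2E setICr.
have split_int (F : R -> \bar R) : measurable_fun [set: Borel R] (F : Borel R -> \bar R) ->
    (forall t, 0 <= F t)%E ->
    (\int[g]_t F t = \int[g]_(t in K) F t + \int[g]_(t in ~` K) F t)%E.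
  move=> mF F0; rewrite KU ge0_integral_setU//; first exact: measurableC.
  by apply: measurable_funS mF.
have H0 t : (0 <= H t)%E by rewrite lee_fin expR_ge0.
have GH t : (~` K) t -> (G t < H t)%E.
  rewrite /= in_itv/= -ler_norml => /negP; rewrite -ltNge => bt.
  by rewrite lte_fin ltr_expR dom.
have mKc : measurable (~` K) by exact: measurableC.
have mGK : measurable_fun (~` K) (G : Borel R -> \bar R) by exact: measurable_funS mG.
have mD : measurable_fun (~` K) ((fun t => H t - G t)%E : Borel R -> \bar R).
  by apply: emeasurable_funB; [exact: measurable_funS mH|exact: measurable_funS mG].
have HGd : (\int[g]_(t in ~` K) H t =
    \int[g]_(t in ~` K) G t + \int[g]_(t in ~` K) (H t - G t))%E.
  have D0 t : (~` K) t -> (0 <= H t - G t)%E by move=> /GH/ltW; rewrite sube_ge0.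
  rewrite -(ge0_integralD g mKc (fun t _ => G0 t) mGK D0 mD).
  by apply: eq_integral => t _; rewrite addeC subeK.
have pos : (0 < \int[g]_(t in ~` K) (H t - G t))%E.
  by apply: integral_gt0 => // t /GH; rewrite sube_gt0.
have HKE : (\int[g]_(t in K) H t = \int[g]_(t in K) G t)%E.
  apply: eq_integral => t; rewrite inE /= in_itv/= -ler_norml => tb.
  by rewrite /H /G clip_id.
clearbody G H.
have HE : lmix mu p0 h y = (lmix mu p0 g y + \int[g]_(t in ~` K) (H t - G t))%E.
  by rewrite hE' gE' (split_int H mH H0) (split_int G mG G0) HKE HGd addeA.
have gfin : lmix mu p0 g y \is a fin_num.
  rewrite ge0_fin_numE ?(ltW (lmix_gt0 _ _))//.
  by apply: le_lt_trans hfin; rewrite HE leeDl// ltW.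
by rewrite HE lteDl.
Qed.

(** Otherwise the clipped measure, admissible because [M] is infinite, would strictly raise the
    likelihood at every observation. *)
Lemma npmle_concentrated n x g : (0 < n)%N -> maxabs n x <= A ->
  (forall i, (i < n)%N -> 0 < p0 (x i)) ->
  npmle mu p0 +oo n x g -> g (~` K) = 0%E.
Proof.
move=> n0 xA px [_ gmax]; apply/eqP/negP => /negP /lmix_clip_gt[h [hK hg]].
have xA' i : (i < n)%N -> `|x i| <= A by move=> /(maxabs_ge x)/le_trans; apply.
have := gmax h (fun t _ => leey _).
have gl i : (i < n)%N -> lmix mu p0 g (x i) = (fine (lmix mu p0 g (x i)))%:E /\
    0 < fine (lmix mu p0 g (x i)).
  move=> i_n; have /andP[h1 h2] := hg _ (xA' _ i_n).
  have gf : lmix mu p0 g (x i) \is a fin_num.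
    by rewrite ge0_fin_numE ?(ltW (lmix_gt0 _ _))// (lt_trans h1).
  by rewrite fineK// fine_gt0// lmix_gt0 -ge0_fin_numE// ltW// lmix_gt0.
have hl i : (i < n)%N -> lmix mu p0 h (x i) = (fine (lmix mu p0 h (x i)))%:E /\
    0 < fine (lmix mu p0 h (x i)).
  move=> i_n; have /andP[h1 h2] := hg _ (xA' _ i_n).
  have hf : lmix mu p0 h (x i) \is a fin_num.
    by rewrite ge0_fin_numE ?(ltW (lmix_gt0 _ _)).
  by rewrite fineK// fine_gt0// lmix_gt0.
rewrite (loglik_real dens (g := g) (l := fun y => fine (lmix mu p0 g y)))//.
rewrite (loglik_real dens (g := h) (l := fun y => fine (lmix mu p0 h y)))//.
rewrite lee_fin lerD2r leNgt => /negP; apply.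
apply: ltr_sum => [|i _]; first by apply/hasP; exists (Ordinal n0); rewrite ?mem_index_enum.
have i_n := ltn_ord i.
rewrite ltr_ln ?posrE ?(gl _ i_n).2 ?(hl _ i_n).2//.
by rewrite -lte_fin -(gl _ i_n).1 -(hl _ i_n).1; have /andP[] := hg _ (xA' _ i_n).
Qed.

(** As for the NPMLE, with nodes for observations: the improvement is strict exactly at nodes of
    positive weight. These lie in [[-A, A]], and they exist because the weights sum to 1. *)
Lemma quad_npmle_concentrated n x J g : (0 < n)%N -> (0 < J)%N -> maxabs n x <= A ->
  quad_npmle mu p0 +oo n x J g -> g (~` K) = 0%E.
Proof.
move=> n0 J0 xA [Q gQ [_ gmax]].
apply/eqP/negP => /negP /lmix_clip_gt[h [hK hg]].
have := gmax h (fun t _ => leey _).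
have [s [q [dQ _ mom qA]]] := gauss_quadrature_discrete n0 J0 gQ.
have q0 t : 0 <= q t by have [] := dQ.
have q1 : \sum_(t <- s) q t = 1.
  have := mom 0; under eq_bigr do rewrite expr0 mulr1.
  move=> ->//; under eq_bigr do rewrite expr0.
  by rewrite sumr_const card_ord mulVf// pnatr_eq0 -lt0n.
have fins t : t \in s -> 0 < q t ->
    exists u v, [/\ lmix mu p0 g t = u%:E, lmix mu p0 h t = v%:E, 0 < u & u < v].
  move=> ts qt; have /andP[h1 h2] := hg _ (le_trans (qA _ ts qt) xA).
  have gf : lmix mu p0 g t \is a fin_num.
    by rewrite ge0_fin_numE ?(ltW (lmix_gt0 _ _))// (lt_trans h1).
  have hf : lmix mu p0 h t \is a fin_num.
    by rewrite ge0_fin_numE ?(ltW (lmix_gt0 _ _)).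
  exists (fine (lmix mu p0 g t)), (fine (lmix mu p0 h t)).
  by rewrite !fineK// -!lte_fin !fineK// lmix_gt0.
rewrite (discrete_integral dQ (lne_lmix_measurable dens h)); last first.
  by move=> t ts /(fins _ ts)[u [v [_ -> u0 uv]]]; rewrite lne_EFin// (lt_trans u0).
rewrite (discrete_integral dQ (lne_lmix_measurable dens g)); last first.
  by move=> t ts /(fins _ ts)[u [v [-> _ u0 uv]]]; rewrite lne_EFin.
have le t : t \in s -> q t * fine (lne (lmix mu p0 g t)) <= q t * fine (lne (lmix mu p0 h t))
   ?= iff (q t == 0).
  move=> ts; have [qt|qt] := ltP 0 (q t); last first.
    have -> : q t = 0 by apply/eqP; rewrite eq_le qt q0.
    by rewrite !mul0r eqxx; exact: leif_refl.
  have [u [v [-> -> u0 uv]]] := fins _ ts qt.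
  have v0 := lt_trans u0 uv.
  rewrite !lne_EFin//= (gt_eqF qt); apply/leifP.
  by rewrite ltr_pM2l// ltr_ln.
have : exists2 t, t \in s & 0 < q t.
  apply: contrapT => nq; have : \sum_(t <- s) q t = 0.
    rewrite big1_seq// => t /andP[_ ts]; apply/eqP; rewrite eq_le q0 andbT leNgt.
    by apply/negP => qt; apply: nq; exists t.
  by rewrite q1 => /eqP; rewrite oner_eq0.
move=> [t0 t0s qt0]; rewrite lee_fin leNgt => /negP; apply.
rewrite (perm_big _ (perm_to_rem t0s)) [ltRHS](perm_big _ (perm_to_rem t0s)) !big_cons/=.
apply: ltr_leD.
  by have := le _ t0s; rewrite (gt_eqF qt0) => /leifP.
rewrite big_seq [leRHS]big_seq; apply: ler_sum => t /mem_rem ts.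
by have [] := le _ ts.
Qed.

End clipped_likelihood.

(** * Order of the quadrature rule *)

Section order_growth.
Variable R : realType.

Lemma powR_ge1 (x e : R) : 1 <= x -> 0 <= e -> 1 <= x `^ e.
Proof. by move=> x1 e0; have := ler_powR x1 e0; rewrite powRr0. Qed.

(** Serves to bound the order from below when [a] is small and the logarithm negative. *)
Lemma mul_ln_ge (a : R) : 0 < a -> -1 <= a * ln a.
Proof.
move=> a0; have := expR_ge1Dx (- ln a); rewrite expRN lnK// => h.
have aa : a * a^-1 = 1 by rewrite divff// gt_eqF.
have := ler_wpM2l (ltW a0) h; rewrite aa; nra.
Qed.

(** The deterministic part of the rate. For [A <= U], [a] is at most of order [U ^ (1 + alpha)],
    that is, [ln n] to the power [(1 + alpha) / beta]. The argument of the logarithm is bounded by a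
    product of powers of [n] and [U], and [ln U <= ln T + ln n / beta], so the logarithm contributes
    one more factor [ln n]. *)
Lemma order_bound (c alpha beta gamma T D p : R) :
  0 < c -> 0 <= alpha -> 0 < beta -> 0 < gamma -> 1 <= T -> 0 <= D -> 0 <= p ->
  exists B : R, forall (n : nat) (A K : R), 1 <= ln n%:R :> R ->
    let U := T * ln n%:R `^ beta^-1 in
    let a := A * (c * A `^ alpha) in
    0 <= A <= U -> 0 <= K <= D * U `^ p ->
    `|(Num.ceil (2 * a * ln (100 * n%:R `^ (1 + gamma) * a * (a + K))))%:~R|
      <= B * ln n%:R `^ (1 + (1 + alpha) / beta).
Proof.
have key (H W y z : R) : 0 <= H -> 1 <= W -> - 4 <= y -> y <= H * W ->
    y <= z -> z < y + 1 -> `|z| <= (5 + H) * W.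
  move=> H0 W1 y1 y2 yz zy; rewrite ler_norml; have := mulr_ge0 H0 (le_trans ler01 W1).
  by rewrite mulrDl; lra.
move=> c0 al0 be0 ga0 T1 D0 p0.
pose e1 := 1 + alpha; pose r := e1 + (e1 + p).
pose E := c * (c + D); have E0 : 0 < E by rewrite mulr_gt0//; lra.
pose F := ln 100 + (1 + gamma) + `|ln E| + r * (ln T + beta^-1).
have T0 : 0 < T by lra.
have lT0 : 0 <= ln T by rewrite ln_ge0.
have l100 : 0 <= ln 100 :> R by rewrite ln_ge0//; lra.
have bi0 : 0 < beta^-1 by rewrite invr_gt0.
have F0 : 0 <= F.
  have h1 : 0 <= r * (ln T + beta^-1) by rewrite mulr_ge0// /r /e1; lra.
  have h2 := normr_ge0 (ln E); rewrite /F; lra.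
exists (5 + 2 * (c * T `^ e1) * F) => n A K L1.
set L := ln n%:R in L1 *; move=> U a /andP[A0 AU] /andP[K0 KU].
have L0 : 0 < L by lra.
have n0 : (0 < n)%N.
  by rewrite lt0n; apply/eqP => n0; move: L0; rewrite /L n0 ln0// ltxx.
have np : 0 < n%:R :> R by rewrite ltr0n.
have Lb1 : 1 <= L `^ beta^-1 by rewrite powR_ge1// ltW.
have U1 : 1 <= U by rewrite /U; nra.
have U0 : 0 < U by lra.
have Le1 : 1 <= L `^ (1 + (1 + alpha) / beta).
  by apply: powR_ge1 => //; have := mulr_ge0 al0 (ltW bi0); lra.
have Ab : A * A `^ alpha <= U `^ e1.
  rewrite /e1 powRD; last by rewrite (gt_eqF U0) implybT.
  rewrite powRr1 ?(ltW U0)//; apply: ler_pM => //; first exact: powR_ge0.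
  by apply: ge0_ler_powR; rewrite ?nnegrE// ltW.
have aU : a <= c * U `^ e1 by rewrite /a mulrCA ler_pM2l.
have a_ge0 : 0 <= a by rewrite /a !mulr_ge0 ?powR_ge0// ltW.
have UE : U `^ e1 = T `^ e1 * L `^ (e1 / beta).
  by rewrite /U powRM ?powR_ge0 ?(ltW T0)// -powRrM [_ * e1]mulrC.
have [a0|a0] := leP a 0.
  have -> : a = 0 by apply/eqP; rewrite eq_le a0.
  rewrite mulr0 mul0r (_ : Num.ceil 0 = 0) ?ceil0// normr0 mulr_ge0 ?powR_ge0//.
  by rewrite addr_ge0// mulr_ge0// mulr_ge0// mulr_ge0 ?powR_ge0// ltW.
set X := n%:R `^ (1 + gamma).
have X1 : 1 <= X.
  by apply: powR_ge1; rewrite ?ler1n//; lra.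
set arg := 100 * X * a * (a + K).
have aK : 0 < a * (a + K) by rewrite mulr_gt0//; lra.
have argE : arg = 100 * X * (a * (a + K)) by rewrite /arg mulrA.
have X0 : 0 < X by exact: lt_le_trans X1.
have p100 : (0 : R) < 100 by [].
have X100 : 0 < 100 * X by exact: mulr_gt0.
have arg0 : 0 < arg by rewrite argE; exact: mulr_gt0.
have lo : 2 * ln a <= ln arg.
  have -> : 2 * ln a = ln (a * a) by rewrite lnM ?posrE//; ring.
  have aa0 : 0 < a * a by rewrite mulr_gt0.
  rewrite (ler_ln aa0 arg0) argE.
  have h1 : a * a <= a * (a + K) by rewrite ler_pM2l//; lra.
  apply: le_trans h1 _; rewrite ler_peMl ?(ltW aK)//; lra.
have Ue1 : 1 <= U `^ e1 by apply: powR_ge1 => //; rewrite /e1; lra.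
have aKE : a * (a + K) <= E * U `^ r.
  have UrE : U `^ r = U `^ e1 * U `^ (e1 + p).
    by rewrite /r powRD// (gt_eqF U0) implybT.
  rewrite UrE /E mulrACA; apply: ler_pM => //; first by lra.
  rewrite mulrDl; apply: lerD.
    by rewrite (le_trans aU)// ler_pM2l// ler_powR//; lra.
  by rewrite (le_trans KU)// ler_wpM2l// ler_powR// /e1; lra.
have hi : ln arg <= F * L.
  have lU : ln U <= ln T + beta^-1 * L.
    rewrite /U lnM ?posrE ?powR_gt0// ln_powR lerD2l ler_pM2l//.
    by have := expR_ge1Dx (ln L); rewrite lnK//; lra.
  have lX : ln X = (1 + gamma) * L by rewrite ln_powR.
  have UR0 : 0 < U `^ r by exact: powR_gt0.
  have EU0 : 0 < E * U `^ r by exact: mulr_gt0.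
  have R0 : 0 < 100 * X * (E * U `^ r) by exact: mulr_gt0.
  have h1 : ln arg <= ln (100 * X * (E * U `^ r)).
    by rewrite (ler_ln arg0 R0) argE (ler_pM2l X100).
  apply: le_trans h1 _.
  rewrite (lnM X100 EU0) (lnM p100 X0) (lnM E0 UR0) ln_powR lX.
  have r0 : 0 <= r by rewrite /r /e1; lra.
  have h2 := ler_wpM2l r0 lU; have h3 := ler_norm (ln E); have h4 := normr_ge0 (ln E).
  have h5 : r * ln T <= r * ln T * L by rewrite ler_peMr// mulr_ge0.
  have h6 : ln 100 <= ln 100 * L :> R by rewrite ler_peMr.
  have h7 : `|ln E| <= `|ln E| * L by rewrite ler_peMr.
  rewrite /F; lra.
set y := 2 * a * ln arg.
(* The argument is at least [a ^ 2], so [y >= 4 a ln a >= - 4]. *)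
have ylo : - 4 <= y by have := mul_ln_ge a0; rewrite /y; nra.
have yhi : y <= 2 * (c * T `^ e1) * F * L `^ (1 + (1 + alpha) / beta).
  rewrite [L `^ _]powRD; last by rewrite (gt_eqF L0) implybT.
  rewrite powRr1 ?(ltW L0)// -/e1.
  apply: (@le_trans _ _ (2 * a * (F * L))).
    by rewrite /y ler_wpM2l// mulr_ge0.
  have h := ler_wpM2r (mulr_ge0 F0 (ltW L0)) aU; rewrite UE in h; lra.
have c1 : y <= (Num.ceil y)%:~R by exact: ceil_ge.
have c2 : (Num.ceil y)%:~R < y + 1 by rewrite -ltrBlDr -[1]/(1%:~R) -intrB; exact: gt_pred_ceil.
have H0 : 0 <= 2 * (c * T `^ e1) * F by rewrite !mulr_ge0 ?powR_ge0// ltW.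
exact: key c1 c2.
Qed.

End order_growth.

(** * Tails of the sample maximum and stochastic order of the rule *)

Section sample_tails.
Variables (R : realType) (d : measure_display) (T : measurableType d).
Variable P : probability T R.
Variable X : nat -> {RV P >-> Borel R}.
Local Notation maxX n w := (maxabs n (fun i => X i w)).

Lemma maxabs_measurable n : measurable_fun [set: T] (fun w => maxX n w : R).
Proof.
rewrite /maxabs; elim: (index_enum _) => [|i s IH].
  by under eq_fun do rewrite big_nil; exact: measurable_cst.
under eq_fun do rewrite big_cons /=.
apply: measurable_maxr; last exact: IH.
by apply: measurableT_comp => //; exact: measurable_funPT.
Qed.

Lemma maxabs_event_measurable n (t : R) : measurable [set w | t <= maxX n w].
Proof.
rewrite -[X in measurable X]setTI.
rewrite (_ : [set w | _] = (fun w => maxX n w) @^-1` `[t, +oo[%classic).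
  by apply: maxabs_measurable => //; exact: measurable_itv.
by apply/seteqP; split => w /=; rewrite in_itv/= andbT.
Qed.

Lemma abs_event_measurable i (t : R) : measurable [set w | t <= `|X i w|].
Proof.
rewrite -[X in measurable X]setTI.
rewrite (_ : [set w | _] = (fun w => `|X i w|) @^-1` `[t, +oo[%classic).
  suff : measurable_fun [set: T] (fun w => `|X i w| : R).
    by apply => //; exact: measurable_itv.
  by apply: measurableT_comp => //; exact: measurable_funPT.
by apply/seteqP; split => w /=; rewrite in_itv/= andbT.
Qed.

Lemma maxabs_union_bound n (t c : R) : 0 < t ->
  (forall i, (P [set w | t <= `|X i w|]%R <= c%:E)%E) ->
  (P [set w | t <= maxX n w]%R <= (n%:R * c)%:E)%E.
Proof.
move=> t0 hc.
apply: (@le_trans _ _ (\sum_(i < n) P [set w | t <= `|X i w|]%R)%E).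
  apply: (@content_subadditive _ _ _ _ [set w | t <= maxX n w]%R (fun i => [set w | t <= `|X i w|]%R) n).
  - by move=> k _; exact: abs_event_measurable.
  - exact: maxabs_event_measurable.
  - move=> w /= tw; apply: contrapT => nt.
    have : maxX n w < t.
      rewrite /maxabs; apply: bigmax_lt => // i _; rewrite ltNge; apply/negP => ti.
      apply: nt.
      rewrite -(bigcup_mkord n (fun k => [set w0 | t <= `|X k w0|]%R)).
      by exists i => //=; exact: ltn_ord.
    by rewrite ltNge tw.
apply: (@le_trans _ _ (\sum_(i < n) c%:E)%E); first by apply: lee_sum => i _.
by rewrite sumEFin sumr_const card_ord mulr_natl.
Qed.

End sample_tails.

Section density_tails.
Variable R : realType.
Variables (mu : measureR R) (p0 : R -> R).
Hypothesis dens : is_density mu p0.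
Local Notation kap := (kappa mu p0).
Variables (d : measure_display) (T : measurableType d) (P : probability T R).
Variables (X : nat -> {RV P >-> Borel R}) (g0 : distR R).
Hypothesis iid : iid_with_density X mu (fmix mu p0 g0).

Lemma density_pos_ae n : \forall w \ae P, forall i, (i < n)%N -> 0 < p0 (X i w).
Proof.
have [mp p0_ge0 _] := dens.
pose S : set (Borel R) := p0 @^-1` [set 0].
have mS : measurable S by rewrite -[S]setTI; apply: mp => //; exact: measurable_set1.
have PS i : P (X i @^-1` S) = 0%E.
  have := iid.2 i S mS; rewrite /distribution /pushforward => ->.
  rewrite (eq_integral (cst 0%E)) ?integral0// => y; rewrite inE /S /= => py.
  by rewrite fmixE// py mule0.
apply: (@negligibleS _ _ _ _ (\bigcup_i (X i @^-1` S))); last first.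
  apply: negligible_bigcup => i; apply/negligibleP; last exact: PS.
  by rewrite -[_ @^-1` _]setTI; exact: measurable_funPT.
move=> w /= /existsNP[i /not_implyP[_ npw]]; exists i => //.
by apply/eqP; rewrite /S /= eq_le p0_ge0 andbT leNgt; apply/negP.
Qed.

(** A Chernoff bound: [l_g0] grows at most like [exp (b |y|)], and the margin [tau] inside [Theta]
    turns [|y| >= t] into a factor [exp (- tau t)]. [D] collects the values of [Z] at the ends of
    the larger interval. *)
Lemma mixture_tail (b tau : R) : 0 <= b -> 0 < tau ->
  `[- (b + tau), b + tau]%classic `<=` Theta mu p0 ->
  g0 (~` `[- b, b]%classic) = 0%E ->
  exists2 D : R, 0 < D &
    forall i t, 0 <= t -> (P [set w | t <= `|X i w|]%R <= (D * expR (- tau * t))%:E)%E.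
Proof.
move=> b0 tau0 bT' gb.
have bT : `[- b, b]%classic `<=` Theta mu p0.
  apply: subset_trans bT' => t; rewrite /= !in_itv/= => /andP[t1 t2].
  apply/andP; split; lra.
have [B kB] := kappa_bounded dens b0 bT.
have [mp p0_ge0 _] := dens.
have c0 : 0 <= b + tau by lra.
have Tb : Theta mu p0 (b + tau) by apply: bT'; rewrite /= in_itv/=; lra.
have Tb' : Theta mu p0 (- (b + tau)) by apply: bT'; rewrite /= in_itv/=; lra.
pose Z1 := fine (Zpart mu p0 (b + tau)); pose Z2 := fine (Zpart mu p0 (- (b + tau))).
have [z1 _] := Zpart_mul_ge1 dens Tb Tb'.
have z2 : 0 <= Z2 by rewrite fine_ge0// Zpart_ge0.
pose E := expR B.
have lb (y : R) : (lmix mu p0 g0 y <= (E * expR (b * `|y|))%:E)%E.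
  rewrite (lmix_concentrated dens b0 bT gb) lee_fin.
  have -> : E * expR (b * `|y|) = \int[g0]_(t in `[- b, b]) (E * expR (b * `|y|)).
    by rewrite Rintegral_cst// [fine _](congr1 fine (concentrated_measure gb)) mulr1.
  apply: le_Rintegral => //.
  - apply: (continuous_tilted_integrable dens g0 b0 bT) => s.
    apply: (cvg_comp (fun s : R => s * y) expR); last exact: continuous_expR.
    by apply: cvgM; [exact: cvg_id|exact: cvg_cst].
  - by apply: finite_measure_integrable_cst.
  - move=> t; rewrite /= in_itv/= -ler_norml => tb.
    rewrite mulrC; apply: ler_pM; rewrite ?expR_ge0// ler_expR.
      by have := kB t tb; rewrite ler_norml lerNl => /andP[].
    by rewrite (le_trans (ler_norm _))// normrM ler_wpM2r.
exists (E * (Z1 + Z2)); first by rewrite mulr_gt0 ?expR_gt0//; rewrite /Z1 in z1 *; lra.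
move=> i t t0.
pose S : set (Borel R) := [set y | t <= `|y|].
have mS : measurable S.
  rewrite -[S]setTI (_ : S = (fun y : R => `|y|) @^-1` `[t, +oo[%classic).
    by apply: (@normr_measurable R setT) => //; exact: measurable_itv.
  by apply/seteqP; split => y /=; rewrite in_itv/= andbT.
have -> : P [set w | t <= `|X i w|]%R = distribution P (X i) S by [].
rewrite iid.2//.
pose h (y : R) := E * expR (- tau * t) * expR ((b + tau) * y) +
   E * expR (- tau * t) * expR (- (b + tau) * y).
have k0 : 0 <= E * expR (- tau * t) by rewrite mulr_ge0 ?expR_ge0.
have h0 y : 0 <= h y by rewrite addr_ge0// mulr_ge0 ?expR_ge0.
have mh : measurable_fun [set: Borel R] ((fun y => (h y * p0 y)%:E) : Borel R -> \bar R).
  apply: (exp_density_measurable dens).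
  rewrite /h; apply: measurable_funD; apply: measurable_funM => //; exact: expRM_measurable.
have mf : measurable_fun [set: Borel R] (fmix mu p0 g0 : Borel R -> \bar R).
  rewrite (_ : fmix mu p0 g0 = (fun y => lmix mu p0 g0 y * (p0 y)%:E)%E).
    apply: emeasurable_funM; first exact: lmix_measurable.
    exact/measurable_EFinP.
  by apply/funext => y; rewrite fmixE.
apply: (@le_trans _ _ (\int[mu]_(y in S) (h y * p0 y)%:E)%E).
  apply: ge0_le_integral => //.
  - by move=> y _; rewrite fmixE// mule_ge0 ?lee_fin// integral_ge0// => u _; rewrite lee_fin expR_ge0.
  - exact: measurable_funS mf.
  - exact: measurable_funS mh.
  - move=> y; rewrite /S /= => ty.
    rewrite fmixE// EFinM lee_wpmul2r ?lee_fin//.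
    apply: le_trans (lb y) _; rewrite lee_fin /h -mulrDr -mulrA ler_pM2l ?expR_gt0//.
    have : expR (b * `|y|) <= expR (- tau * t) * expR ((b + tau) * `|y|).
      by rewrite -expRD ler_expR; nra.
    move=> /le_trans; apply; rewrite ler_pM2l ?expR_gt0//.
    have [y0|y0] := leP 0 y; first by rewrite ger0_norm// lerDl expR_ge0.
    by rewrite ltr0_norm// mulrN -mulNr lerDr expR_ge0.
apply: (@le_trans _ _ (\int[mu]_y (h y * p0 y)%:E)%E).
  apply: ge0_subset_integral => //.
  by move=> y _; rewrite lee_fin mulr_ge0.
rewrite integral_exp_combination// -(fineK (Zpart_fin_num dens Tb)) -(fineK (Zpart_fin_num dens Tb')).
rewrite -!EFinM -EFinD lee_fin -/Z1 -/Z2 le_eqVlt; apply/orP; left; apply/eqP; ring.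
Qed.

End density_tails.

Section quadrature_order.
Variable R : realType.
Variables (mu : measureR R) (p0 : R -> R).
Local Notation S v := (sup [set `|kappa mu p0 t| | t in `[- v, v]%classic]).
Variables (d : measure_display) (T : measurableType d) (P : probability T R).
Variable X : nat -> {RV P >-> Borel R}.
Local Notation maxX n w := (maxabs n (fun i => X i w)).

(** Events are compared below by monotonicity of [P], which requires the event on the order to be
    measurable. The ceiling is treated as a monotone function. *)
Lemma quad_order_measurable (gamma : R) (n : nat) (M : R -> R) :
  measurable_fun [set: Borel R] (M : Borel R -> Borel R) ->
  measurable_fun [set: Borel R] ((fun A => S (M A)) : Borel R -> Borel R) ->
  measurable_fun [set: T] (fun w =>
    (quad_order mu p0 100 gamma n (fun i => X i w) (M (maxX n w)))%:~R : R).
Proof.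
move=> mM mS.
pose h (A : R) : R := (Num.ceil (2 * (A * M A) *
  ln (100 * n%:R `^ (1 + gamma) * (A * M A) * (A * M A + S (M A)))))%:~R.
have mh : measurable_fun [set: Borel R] (h : Borel R -> Borel R).
  have mA : measurable_fun [set: Borel R] ((fun A => A * M A) : Borel R -> Borel R).
    exact: measurable_funM.
  apply: (measurableT_comp (f := fun y : R => (Num.ceil y)%:~R : R)).
    apply: nondecreasing_measurable => // y z yz.
    by rewrite ler_int le_ceil.
  apply: measurable_funM; first exact: measurable_funM.
  apply: (measurableT_comp (f := @ln R)) => //.
  apply: measurable_funM; first exact: measurable_funM.
  exact: measurable_funD.
exact: (measurableT_comp mh (maxabs_measurable X n)).
Qed.

(** Let [U = T0 (ln n) ^ (1 / beta)]; off the event [U <= |X|_n], [order_bound] applies. [T0] is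
    chosen so that [b1 U ^ beta >= 2 ln n], and the event then has probability at most
    [n D0 n ^ -2 = D0 / n]. *)
Lemma quad_order_bounded_in_prob (c alpha beta b0 b1 gamma D0 D p : R) :
  0 < c -> 0 <= alpha -> 0 < beta -> 0 < b0 -> 0 < b1 -> 0 < gamma ->
  0 < D0 -> 0 <= D -> 0 <= p ->
  (forall (n : nat) (t : R), (0 < n)%N -> b0 <= t ->
    (P [set w | t <= maxX n w]%R <= (n%:R * (D0 * expR (- b1 * t `^ beta)))%:E)%E) ->
  (forall A U : R, 0 <= A <= U -> 1 <= U -> 0 <= S (c * A `^ alpha) <= D * U `^ p) ->
  measurable_fun [set: Borel R] ((fun A => S (c * A `^ alpha)) : Borel R -> Borel R) ->
  bounded_in_prob P (fun n w => (quad_order mu p0 100 gamma n (fun i => X i w)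
      (c * maxX n w `^ alpha))%:~R) (fun n => ln n%:R `^ (1 + (1 + alpha) / beta)).
Proof.
move=> c0 al0 be0 b0_gt0 b1_gt0 ga0 D0_gt0 D_ge0 p_ge0 tail hS mS e e0.
pose T0 := 1 + b0 + (2 / b1) `^ beta^-1.
have T1 : 1 <= T0 by rewrite /T0; have := powR_ge0 (2 / b1) beta^-1; lra.
have Tb0 : b0 <= T0 by rewrite /T0; have := powR_ge0 (2 / b1) beta^-1; lra.
have T0_gt0 : 0 < T0 by lra.
have Tbeta : 2 <= b1 * T0 `^ beta.
  have q0 : 0 <= 2 / b1 by rewrite divr_ge0 ?(ltW b1_gt0).
  have : ((2 / b1) `^ beta^-1) `^ beta <= T0 `^ beta.
    apply: ge0_ler_powR; rewrite ?nnegrE ?powR_ge0 ?(ltW be0) ?(ltW T0_gt0)//.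
    by rewrite /T0; lra.
  rewrite -powRrM mulVf ?gt_eqF// powRr1// => h.
  have := ler_wpM2l (ltW b1_gt0) h; rewrite mulrC divfK ?gt_eqF//.
have [B hB] := order_bound c0 al0 be0 ga0 T1 D_ge0 p_ge0.
exists B.
near=> n.
have ne : expR 1 <= n%:R :> R by near: n; exact: nbhs_infty_ger.
have nD : D0 / e <= n%:R :> R by near: n; exact: nbhs_infty_ger.
have np : 0 < n%:R :> R by apply: lt_le_trans ne; exact: expR_gt0.
have n0 : (0 < n)%N by rewrite -(ltr0n R).
have L1 : 1 <= ln n%:R :> R by rewrite -[leLHS]expRK ler_ln ?posrE ?expR_gt0.
have L0 : 0 < ln n%:R :> R by lra.
set L : R := ln n%:R in L1 L0 *.
pose U := T0 * L `^ beta^-1.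
have Lb1 : 1 <= L `^ beta^-1 by apply: powR_ge1 => //; rewrite invr_ge0 ltW.
have U1 : 1 <= U by rewrite /U; nra.
have b0U : b0 <= U by rewrite /U; nra.
apply: (@le_trans _ _ (P [set w | U <= maxX n w]%R)).
  apply: le_measure; rewrite ?inE.
  - pose Y w : R := (quad_order mu p0 100 gamma n (fun i => X i w)
      (c * maxX n w `^ alpha))%:~R.
    have mY : measurable_fun [set: T] (fun w => `|Y w / L `^ (1 + (1 + alpha) / beta)|).
      apply: measurableT_comp => //; apply: measurable_funM => //.
      apply: (@quad_order_measurable gamma n (fun A => c * A `^ alpha)) => //.
      by apply: measurable_funM => //; exact: measurable_powR.
    rewrite -[X in measurable X]setTI.
    rewrite (_ : [set w | _] =
        (fun w => `|Y w / L `^ (1 + (1 + alpha) / beta)|) @^-1` `]B, +oo[%classic).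
      by apply: mY => //; exact: measurable_itv.
    by apply/seteqP; split => w /=; rewrite in_itv/= andbT.
  - exact: maxabs_event_measurable.
  - move=> w /=; apply: contraTT; rewrite -ltNge -leNgt => /ltW wU.
    have A0 := maxabs_ge0 n (fun i => X i w).
    have AU : 0 <= maxX n w <= U by rewrite A0.
    have := hB n (maxX n w) (S (c * maxX n w `^ alpha)) L1 AU (hS _ _ AU U1).
    rewrite -/L -[Num.ceil _]/(quad_order mu p0 100 gamma n (fun i => X i w)
      (c * maxX n w `^ alpha)) => h.
    have La : 0 < L `^ (1 + (1 + alpha) / beta) by exact: powR_gt0.
    by rewrite normrM normfV (gtr0_norm La) ler_pdivrMr.
apply: le_trans (tail n U n0 b0U) _.
rewrite lee_fin.
have UL : 2 * L <= b1 * U `^ beta.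
  rewrite /U powRM ?powR_ge0 ?(ltW T0_gt0)// -powRrM mulVf ?gt_eqF// powRr1 ?(ltW L0)//.
  by rewrite mulrA ler_pM2r.
have : expR (- b1 * U `^ beta) <= n%:R^-1 * n%:R^-1.
  have -> : n%:R^-1 * n%:R^-1 = expR (- L + - L) :> R.
    by rewrite expRD expRN lnK ?posrE.
  by rewrite ler_expR mulNr -opprD lerN2 -[L + L]mulr2n -[L *+ 2]mulr_natl.
move=> h; apply: (@le_trans _ _ (n%:R * (D0 * (n%:R^-1 * n%:R^-1)))).
  by rewrite ler_pM2l// ler_pM2l.
have -> : n%:R * (D0 * (n%:R^-1 * n%:R^-1)) = D0 / n%:R by field; rewrite gt_eqF.
by rewrite ler_pdivrMr// mulrC -ler_pdivrMr.
Unshelve. all: by end_near.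
Qed.

End quadrature_order.

(** * Consequences of the growth condition on kappa *)

Section superquadratic_family.
Variable R : realType.
Variables (mu : measureR R) (p0 : R -> R).
Hypothesis dens : is_density mu p0.
Hypothesis allT : forall t, Theta mu p0 t.
Local Notation kap := (kappa mu p0).
Local Notation S v := (sup [set `|kap t| | t in `[- v, v]%classic]).

Let bT (b : R) : `[- b, b]%classic `<=` Theta mu p0.
Proof. by move=> t _; exact: allT. Qed.

(** Monotonicity yields measurability of the order when [M_n] is random. For negative [v] the
    interval is empty and [sup set0 = 0], which is below the nonnegative values that follow. *)
Lemma kappa_sup_nondecreasing : nondecreasing_fun (fun v : R => S v).
Proof.
move=> u v uv.
have neg (w : R) : w < 0 -> S w = 0.
  move=> w0; rewrite [X in sup X](_ : _ = set0) ?sup0//.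
  apply/seteqP; split => // y [t]; rewrite /= in_itv/= => /andP[t1 t2] _.
  by have := le_trans t1 t2; lra.
have [v0|v0] := ltP v 0; first by rewrite !neg//; lra.
have [u0|u0] := ltP u 0.
  by rewrite neg//; exact: (kappa_sup_ge0 dens v0 (@bT v)).
have [B kB] := kappa_bounded dens v0 (@bT v).
apply: sup_le_ub.
  by exists `|kap 0|; exists 0 => //=; rewrite in_itv/= oppr_le0 u0.
move=> _ [t + <-]; rewrite /= in_itv/= => /andP[t1 t2]; apply: ub_le_sup.
  by exists B => _ [s + <-]; rewrite /= in_itv/= -ler_norml => /kB.
by exists t => //=; rewrite in_itv/=; apply/andP; split; lra.
Qed.

Lemma kappa_addN_ge0 t : 0 <= kap t + kap (- t).
Proof.
have [z1 h] := Zpart_mul_ge1 dens (allT t) (allT (- t)).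
have [z2 _] := Zpart_mul_ge1 dens (allT (- t)) (allT (- - t)).
by rewrite /kappa -(lnM z1 z2) ln_ge0.
Qed.

Variables (a1 a2 c0 c1 c2 : R).
Hypothesis a2_gt0 : 0 < a2.
Hypothesis a21 : a2 <= a1.
Hypothesis c0_gt0 : 0 < c0.
Hypothesis c1_gt0 : 0 < c1.
Hypothesis growth : forall t : R, c0 <= `|t| ->
  c1 * `|t| `^ (1 + a1^-1) <= kap t /\ kap t <= c2 * `|t| `^ (1 + a2^-1).

(** [kappa_star] bounds [kappa] from above by its value at the endpoint of the same sign, where the
    growth condition is available; [kappa_addN_ge0] then gives the lower bound. *)
Lemma kappa_abs_le (V t : R) : c0 <= V -> `|t| <= V -> `|kap t| <= c2 * V `^ (1 + a2^-1).
Proof.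
move=> cV tV; have V0 : 0 < V by exact: lt_le_trans cV.
suff h u : `|u| <= V -> kap u <= c2 * V `^ (1 + a2^-1).
  rewrite ler_norml h// andbT lerNl; apply: le_trans (h (- t) _); last by rewrite normrN.
  by rewrite -subr_ge0 opprK addrC kappa_addN_ge0.
move=> uV; have nV (s : R) : `|s| = V -> 0 <= kap s <= c2 * V `^ (1 + a2^-1).
  move=> sV; have := @growth s; rewrite sV => /(_ cV)[g1 ->]; rewrite andbT.
  by apply: le_trans g1; rewrite mulr_ge0 ?powR_ge0// ltW.
pose s : R := if 0 <= u then V else - V.
have sV : `|s| = V by rewrite /s; case: ifPn => _; rewrite ?normrN gtr0_norm.
have us : u = `|u| / V * s.
  rewrite /s; case: ifPn => [u0|]; first by rewrite ger0_norm// divfK// gt_eqF.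
  by rewrite -ltNge => u0; rewrite ltr0_norm// mulrN mulNr mulNr opprK divfK// gt_eqF.
have l01 : 0 <= `|u| / V <= 1.
  by rewrite divr_ge0 ?(ltW V0)//= ler_pdivrMr// mul1r.
have /andP[s0 sle] := nV s sV.
rewrite us; apply: le_trans (kappa_star dens s allT l01) _.
by apply: le_trans sle; rewrite ler_piMl//; have /andP[] := l01.
Qed.

(** The interval is first enlarged from [c A ^ a1] to [c U ^ a1], which is at least [c0] even if [A]
    is small. *)
Lemma kappa_sup_growth (c A U : R) : c0 <= c -> 0 <= A <= U -> 1 <= U ->
  0 <= S (c * A `^ a1) <= c2 * c `^ (1 + a2^-1) * U `^ (a1 * (1 + a2^-1)).
Proof.
move=> cc /andP[A0 AU] U1.
have a1_gt0 : 0 < a1 by exact: lt_le_trans a21.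
have cp : 0 < c by exact: lt_le_trans cc.
have b0 : 0 <= c * A `^ a1 by rewrite mulr_ge0 ?powR_ge0// ltW.
rewrite (kappa_sup_ge0 dens b0 (@bT _))/=.
have Ua : 1 <= U `^ a1 by apply: powR_ge1 => //; exact: ltW.
have AUa : A `^ a1 <= U `^ a1.
  by apply: ge0_ler_powR; rewrite ?nnegrE ?(ltW a1_gt0)//; lra.
have -> : c2 * c `^ (1 + a2^-1) * U `^ (a1 * (1 + a2^-1)) =
    c2 * (c * U `^ a1) `^ (1 + a2^-1).
  by rewrite powRM ?powR_ge0 ?(ltW cp)// -powRrM mulrA.
apply: sup_le_ub.
  by exists `|kap 0|; exists 0 => //=; rewrite in_itv/= oppr_le0 b0.
move=> _ [t + <-]; rewrite /= in_itv/= -ler_norml => tb.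
apply: kappa_abs_le; first by nra.
by apply: le_trans tb _; rewrite ler_pM2l.
Qed.

(* Convexity makes the slope of [kap] beyond [c A^a1] exceed [A], so moving a
   distant atom back to the interval raises the likelihood of every point of
   [[-A, A]]. *)
Lemma clip_dominates (c A t x : R) : c0 <= c -> 2 <= c1 * c `^ a1^-1 -> 1 <= A ->
  c * A `^ a1 < `|t| -> `|x| <= A ->
  t * x - kap t < clip (c * A `^ a1) t * x - kap (clip (c * A `^ a1) t).
Proof.
have key (u v w z y q : R) : y - q <= u -> w <= v -> 2 * u <= w - z -> 0 < u ->
    y - v < q - z by lra.
move=> cc c12 A1; set b := c * A `^ a1 => bt xA.
have a1_gt0 : 0 < a1 by exact: lt_le_trans a21.
have cp : 0 < c by exact: lt_le_trans cc.
have Aa : 1 <= A `^ a1 by apply: powR_ge1 => //; exact: ltW.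
have bc : c <= b by rewrite /b; nra.
have bp : 0 < b by lra.
have tp : 0 < `|t| by lra.
pose l := b / `|t|.
have l01 : 0 <= l <= 1.
  by rewrite /l divr_ge0 ?(ltW bp)//= ler_pdivrMr// mul1r ltW.
have lt1 : l < 1 by rewrite /l ltr_pdivrMr// mul1r.
have lb : l * `|t| = b by rewrite /l divfK// gt_eqF.
have l0 : 0 < l by rewrite /l divr_gt0.
clearbody l.
have cE : clip b t = l * t.
  have [t0|t0] := leP 0 t.
    move: bt lb; rewrite ger0_norm// => bt ->.
    by rewrite /clip min_l ?(ltW bt)// max_r//; lra.
  move: bt lb; rewrite ltr0_norm// => bt lb.
  by rewrite /clip min_r ?max_l//; lra.
rewrite cE.
have star := kappa_star dens t allT l01.
have nlt : `|l * t| = b by rewrite normrM (gtr0_norm l0).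
have [glow _] : c1 * `|l * t| `^ (1 + a1^-1) <= kap (l * t) /\
    kap (l * t) <= c2 * `|l * t| `^ (1 + a2^-1).
  by apply: growth; rewrite nlt; exact: le_trans bc.
(* Since [b ^ (1 / a1) = c ^ (1 / a1) A], the growth condition at the endpoint gives a slope from 0
   of at least [2 A], twice the largest [|x|]. *)
have bpow : b * (2 * A) <= kap (l * t).
  move: glow; rewrite nlt powRD; last by rewrite (gt_eqF bp) implybT.
  rewrite powRr1 ?(ltW bp)// [b `^ a1^-1]powRM ?powR_ge0 ?(ltW cp)//.
  rewrite -powRrM mulfV ?gt_eqF// (powRr1 (le_trans ler01 A1)).
  apply: le_trans.
  have -> : b * (2 * A) = 2 * (b * A) by ring.
  have -> : c1 * (b * (c `^ a1^-1 * A)) = c1 * c `^ a1^-1 * (b * A) by ring.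
  exact: (ler_wpM2r (mulr_ge0 (ltW bp) (le_trans ler01 A1)) c12).
have l1 : 0 < 1 - l by rewrite subr_gt0.
have A0 : 0 < A by exact: lt_le_trans A1.
have xt : (1 - l) * (t * x) <= (1 - l) * (`|t| * A).
  rewrite ler_pM2l//.
  by rewrite (le_trans (ler_norm _))// normrM ler_wpM2l.
have k1 : kap (l * t) / l <= kap t by rewrite ler_pdivrMr// [kap t * l]mulrC.
have k2 : (1 - l) * (`|t| * (2 * A)) <= (1 - l) * (kap (l * t) / l).
  rewrite ler_pM2l//.
  rewrite (ler_pdivlMr _ _ l0) (_ : _ * l = l * `|t| * (2 * A)); last by ring.
  rewrite lb; exact: bpow.
have k3 : (1 - l) * (kap (l * t) / l) = kap (l * t) / l - kap (l * t).
  by field; rewrite gt_eqF.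
have k4 : 0 < (1 - l) * (`|t| * A) by rewrite !mulr_gt0.
have k5 : (1 - l) * (t * x) = t * x - l * t * x by ring.
have k6 : (1 - l) * (`|t| * (2 * A)) = 2 * ((1 - l) * (`|t| * A)) by ring.
move: xt k1 k2 k4; rewrite k3 k5 k6; exact: key.
Qed.

End superquadratic_family.

Theorem corollary2p1 (R : realType) :
  exists2 C : R, 0 < C &
  forall (mu : measureR R) (p0 : R -> R) (M : \bar R),
    is_density mu p0 -> (0 < M)%E -> Theta0 M `<=` Theta mu p0 ->
  (* (i) *)
  (cond_S1 mu p0 M ->
    forall (gamma : R) (d : measure_display) (T : measurableType d)
      (P : probability T R) (X : nat -> {RV P >-> Borel R}) (g0 : distR R),
      0 < gamma -> mixing M g0 -> iid_with_density X mu (fmix mu p0 g0) ->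
    let Mn := fine M in
    let Jn n w := quad_order mu p0 C gamma n (fun i => X i w) Mn in
    (forall n, (0 < n)%N -> \forall w \ae P,
      let x i := X i w in
      (forall gh, npmle mu p0 M n x gh ->
        supp gh `<=` `[- Mn, Mn]%classic) /\
      (forall J gJ, (0 < J)%N -> Jn n w = J%:Z ->
        quad_npmle mu p0 M n x J gJ ->
        supp gJ `<=` `[- Mn, Mn]%classic /\
        (1 <= maxabs n x * Mn -> forall gh, npmle mu p0 M n x gh ->
          (loglik n x (fmix mu p0 gh) - loglik n x (fmix mu p0 gJ)
            <= (n%:R `^ (- gamma))%:E)%E))) /\
    bounded_in_prob P (fun n w => (Jn n w)%:~R) (fun n => ln n%:R ^+ 2)) /\
  (* (ii) *)
  (forall alpha1 alpha2 c0 c1 c2 : R,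
    cond_S2 mu p0 M alpha1 alpha2 c0 c1 c2 ->
    exists2 Cp0 : R, 0 < Cp0 &
    forall (gamma : R) (d : measure_display) (T : measurableType d)
      (P : probability T R) (X : nat -> {RV P >-> Borel R}) (g0 : distR R)
      (beta0 b0 b1 : R),
      0 < gamma -> mixing M g0 -> iid_with_density X mu (fmix mu p0 g0) ->
      cond_LT X beta0 b0 b1 ->
    let Mn n w := Cp0 * maxabs n (fun i => X i w) `^ alpha1 in
    let Jn n w := quad_order mu p0 C gamma n (fun i => X i w) (Mn n w) in
    (forall n, (0 < n)%N -> \forall w \ae P,
      let x i := X i w in
      1 <= maxabs n x ->
      (forall gh, npmle mu p0 M n x gh ->
        supp gh `<=` `[- Mn n w, Mn n w]%classic) /\
      (forall J gJ, (0 < J)%N -> Jn n w = J%:Z ->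
        quad_npmle mu p0 M n x J gJ ->
        supp gJ `<=` `[- Mn n w, Mn n w]%classic /\
        (1 <= maxabs n x * Mn n w -> forall gh, npmle mu p0 M n x gh ->
          (loglik n x (fmix mu p0 gh) - loglik n x (fmix mu p0 gJ)
            <= (n%:R `^ (- gamma))%:E)%E))) /\
    bounded_in_prob P (fun n w => (Jn n w)%:~R)
      (fun n => ln n%:R `^ (1 + (1 + alpha1) / beta0))).
Proof.
exists 100 => // mu p0 M dens M0 ThM; split.
- case: M M0 ThM => [m| |] //; last by move=> _ _ [].
  rewrite lte_fin => m0 ThM [_ [tau tau0 tauT]] gamma d T P X g0 ga0 mix0 iid Mn Jn.
  have bT : `[- m, m]%classic `<=` Theta mu p0.
    by move=> t; rewrite /= in_itv/= -ler_norml => tm; apply: ThM; rewrite /Theta0 /= lee_fin.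
  have supM (g : distR R) : mixing m%:E g -> supp g `<=` `[- m, m]%classic.
    by move=> mg t /mg; rewrite /Theta0 /= lee_fin in_itv/= -ler_norml.
  have conc (g : distR R) : mixing m%:E g -> g (~` `[- m, m]%classic) = 0%E.
    by move=> /supM; exact: supp_subset_null.
  split.
    move=> n n0; have := density_pos_ae dens iid n; apply: filterS => w px; pose x i := X i w.
    split; first by move=> gh [mh _]; exact: supM.
    move=> J gJ J0 JE [Q gQ [mJ maxJ]]; split; first exact: supM.
    move=> a1 gh [mh _].
    by apply: (loglik_comparison dens n0 J0 ga0 (ltW m0) bT (conc _ mh) (conc _ mJ)
      px a1 JE gQ); exact: maxJ.
  have bT' : `[- (m + tau), m + tau]%classic `<=` Theta mu p0.
    by move: tauT; rewrite /= -opprD.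
  have [D D0 tailX] := mixture_tail dens iid (ltW m0) tau0 bT' (conc _ mix0).
  have tail (n : nat) (t : R) : (0 < n)%N -> 1 <= t ->
      (P [set w | t <= maxabs n (fun i => X i w)]%R <=
       (n%:R * (D * expR (- tau * t `^ 1)))%:E)%E.
    move=> _ t1; rewrite powRr1; last by lra.
    apply: maxabs_union_bound; first by lra.
    by move=> i; apply: tailX; lra.
  pose S := sup [set `|kappa mu p0 t| | t in `[- m, m]%classic].
  have S0 : 0 <= S by exact: (kappa_sup_ge0 dens (ltW m0) bT).
  (* A constant [M_n = m] is the case [alpha = 0], as the power 0 equals 1 even at 0; the
     exponential tail is the case [beta = 1]. *)
  have := @quad_order_bounded_in_prob R mu p0 d T P X m 0 1 1 tau gamma D S 0
    m0 (lexx 0) ltr01 ltr01 tau0 ga0 D0 S0 (lexx 0) tail.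
  have -> : (fun n w => (quad_order mu p0 100 gamma n (fun i => X i w)
      (m * maxabs n (fun i => X i w) `^ 0))%:~R) =
     (fun n w => (Jn n w)%:~R) :> (nat -> T -> R).
    by apply/funext => n; apply/funext => w; rewrite powRr0 mulr1.
  move=> H e e0; have [||B hB] := H _ _ e e0.
  + by move=> A U _ U1; rewrite !powRr0 !mulr1 -/S S0 lexx.
  + rewrite (_ : (fun _ => _) = cst S) //.
    by apply/funext => A; rewrite powRr0 mulr1.
  (* [n >= 1] gives [ln n >= 0], where the real power 2 is the square. *)
  exists B; apply: filterS2 (nbhs_infty_ger (1 : R)) hB => n n1.
  have -> : 1 + (1 + 0) / 1 = 2%:R :> R by lra.
  by rewrite powR_mulrn// ln_ge0.
- move=> alpha1 alpha2 c0 c1 c2 [Minf _ [a2 a21] [c0_gt0 c1_gt0 c2_gt0] growth].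
  have allT t : Theta mu p0 t by apply: ThM; rewrite Minf /Theta0 /= leey.
  have a1 : 0 < alpha1 by exact: lt_le_trans a21.
  (* The first term makes the growth condition available at the endpoints of [[-M_n, M_n]], the
     second gives the slope [2 A] there. *)
  pose Cp0 := Num.max c0 ((2 / c1) `^ alpha1).
  have Cc0 : c0 <= Cp0 by rewrite le_max lexx.
  have Cp0_gt0 : 0 < Cp0 by exact: lt_le_trans Cc0.
  have c12 : 2 <= c1 * Cp0 `^ alpha1^-1.
    have q0 : 0 <= 2 / c1 by rewrite divr_ge0// ltW.
    have : ((2 / c1) `^ alpha1) `^ alpha1^-1 <= Cp0 `^ alpha1^-1.
      apply: ge0_ler_powR; rewrite ?nnegrE ?powR_ge0 ?invr_ge0 ?(ltW a1) ?(ltW Cp0_gt0)//.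
      by rewrite le_max lexx orbT.
    rewrite -powRrM mulfV ?gt_eqF// powRr1// => h.
    have := ler_wpM2l (ltW c1_gt0) h.
    by rewrite [c1 * (2 / c1)]mulrC divfK ?gt_eqF.
  exists Cp0 => // gamma d T P X g0 beta0 b0 b1 ga0 mix0 iid [be0 b0_gt0 b1_gt0 LT] Mn Jn.
  split.
    move=> n n0; have := density_pos_ae dens iid n; apply: filterS => w px A1; pose x i := X i w.
    pose b := Cp0 * maxabs n x `^ alpha1.
    have b_ge0 : 0 <= b by rewrite mulr_ge0 ?powR_ge0// ltW.
    have dom (t y : R) := @clip_dominates R mu p0 dens allT alpha1 alpha2 c0 c1 c2 a2 a21
      c0_gt0 growth Cp0 (maxabs n x) t y Cc0 c12 A1.
    have bT : `[- b, b]%classic `<=` Theta mu p0 by move=> t _; exact: allT.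
    have conc1 gh : npmle mu p0 M n x gh -> gh (~` `[- b, b]%classic) = 0%E.
      by rewrite Minf; exact: (npmle_concentrated dens allT b_ge0 dom n0 (lexx _) px).
    have conc2 J gJ : (0 < J)%N -> quad_npmle mu p0 M n x J gJ ->
        gJ (~` `[- b, b]%classic) = 0%E.
      by rewrite Minf => J0; exact: (quad_npmle_concentrated dens allT b_ge0 dom n0 J0 (lexx _)).
    split; first by move=> gh /conc1; exact: concentrated_supp.
    move=> J gJ J0 JE qJ; have gJb := conc2 _ _ J0 qJ.
    split; first exact: concentrated_supp.
    move=> a1' gh /[dup] /conc1 ghb [mh _].
    have [Q gQ [mJ maxJ]] := qJ.
    by apply: (loglik_comparison dens n0 J0 ga0 b_ge0 bT ghb gJb px a1' JE gQ); exact: maxJ.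
  have D_ge0 : 0 <= c2 * Cp0 `^ (1 + alpha2^-1) by rewrite mulr_ge0 ?powR_ge0// ltW.
  have p_ge0 : 0 <= alpha1 * (1 + alpha2^-1).
    by rewrite mulr_ge0 ?(ltW a1)// addr_ge0// invr_ge0 ltW.
  apply: (@quad_order_bounded_in_prob R mu p0 d T P X Cp0 alpha1 beta0 b0 b1 gamma 1
    _ _ Cp0_gt0 (ltW a1) be0 b0_gt0 b1_gt0 ga0 ltr01 D_ge0 p_ge0).
  + by move=> n t n0 bt; rewrite mul1r; exact: LT.
  + move=> A U AU U1.
    exact: (kappa_sup_growth dens allT a2 a21 c0_gt0 c1_gt0 growth Cc0 AU U1).
  + apply: (measurableT_comp (f := fun v : R =>
      sup [set `|kappa mu p0 t| | t in `[- v, v]%classic])).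
      apply: nondecreasing_measurable => //; exact: kappa_sup_nondecreasing.
    by apply: measurable_funM => //; exact: measurable_powR.
Qed.
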